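(* Let $M\subseteq\mathcal B(H)$ and $N\subseteq\mathcal B(K)$ be von Neumann algebras, and let $\theta\colon N\to M$ be a normal completely positive map. Let $L$ be a Hilbert space and $v\colon H\to K\otimes L$ a bounded operator with $\theta(y)=v^*(y\otimes 1)v$ for all $y\in N$. Then $$V=\overline{\mathrm{lin}}^{\,w^*}\{\,y'(1\otimes\langle\xi|)v : \xi\in L,\ y'\in N'\,\}\subseteq\mathcal B(H,K)$$ is a quantum relation from $M$ to $N$, which depends only on $\theta$ and not on the choice of $(L,v)$. Indeed, if $(\pi_0,H_0,v_0)$ is a minimal dilation of $\theta$ and $$V^{\pi_0}=\{x\in\mathcal B(H_0,K): yx=x\pi_0(y)\ (y\in N)\},$$ then $V$ is the weak$^*$-closure of $\{xv_0 : x\in V^{\pi_0}\}$.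
   Context: A quantum relation from $M\subseteq\mathcal B(H)$ to $N\subseteq\mathcal B(K)$ is a weak$^*$-closed subspace $V\subseteq\mathcal B(H,K)$ with $axb\in V$ whenever $x\in V$, $a\in N'$, $b\in M'$. For $\xi\in L$, $\langle\xi|\colon L\to\mathbb C$ is the map $\eta\mapsto(\xi|\eta)$ (inner products are linear in the second variable), so $1\otimes\langle\xi|\colon K\otimes L\to K$. $\overline{\mathrm{lin}}^{\,w^*}$ denotes weak$^*$-closed linear span. A minimal dilation of $\theta$ is a triple $(\pi_0,H_0,v_0)$ with $\pi_0\colon N\to\mathcal B(H_0)$ a normal unital $*$-homomorphism and $v_0\in\mathcal B(H,H_0)$ such that $\theta(y)=v_0^*\pi_0(y)v_0$ for all $y\in N$ and $\mathrm{lin}\{\pi_0(y)v_0\xi : y\in N,\xi\in H\}$ is dense in $H_0$. *)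

(* Defs.v *)
From HB Require Import structures.
From mathcomp Require Import all_boot all_order all_algebra.
From mathcomp Require Import complex.
From mathcomp Require Import all_classical all_reals all_analysis.

Set Implicit Arguments.
Unset Strict Implicit.
Unset Printing Implicit Defensive.

Import Order.TTheory GRing.Theory Num.Theory Num.Def.
Import numFieldNormedType.Exports.

Local Open Scope classical_set_scope.
Local Open Scope ring_scope.
Local Open Scope complex_scope.

HB.mixin Record CompleteNormedModule_isHilbert (R : realType) (H : Type)
    & CompleteNormedModule R[i] H := {
  hform : {dot H for @conjC R[i]} ;
  hform_norm : forall x : H, hform x x = `|x| ^+ 2
}.

#[short(type="hilbertType")]
HB.structure Definition Hilbert (R : realType) :=
  {H of CompleteNormedModule R[i] H & CompleteNormedModule_isHilbert R H}.

(* Library sesquilinear forms are linear in the first variable, hence the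
   swap: [inner x y] is linear in [y] and conjugate-linear in [x]. *)
Definition inner (R : realType) (H : hilbertType R) (x y : H) : R[i] :=
  hform y x.


Definition bounded_linear {R : realType} {H K : hilbertType R} :
  {pred H -> K} := fun f => `[< linear f /\ continuous f >].

Lemma bounded_linear_submod (R : realType) (H K : hilbertType R) :
  submod_closed (@bounded_linear R H K).
Proof.
split.
  apply/asboolP; split; first by move=> a x y /=; rewrite scaler0 addr0.
  by move=> x; exact: cvg_cst.
move=> a f g /asboolP[lf cf] /asboolP[lg cg]; apply/asboolP; split.
  move=> b x y; rewrite !fctE/=.
  rewrite lf lg !scalerDr !scalerA mulrC -!addrA; congr (_ + _).
  by rewrite addrCA.
by move=> x; apply: cvgD; [apply: cvgZl_tmp; exact: cf|exact: cg].
Qed.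

HB.instance Definition _ (R : realType) (H K : hilbertType R) :=
  GRing.isSubmodClosed.Build R[i] (H -> K) (@bounded_linear R H K)
    (@bounded_linear_submod R H K).

Record bounded_op (R : realType) (H K : hilbertType R) := BoundedOp {
  bounded_op_fun :> H -> K ;
  bounded_opP : bounded_op_fun \in bounded_linear }.

Notation "''B' ( H , K )" := (bounded_op H K)
  (format "''B' ( H ,  K )") : type_scope.
Notation "''B' ( H )" := (bounded_op H H) (format "''B' ( H )") : type_scope.

Section BoundedOpLmodule.
Context {R : realType} (H K : hilbertType R).

HB.instance Definition _ := [isSub for @bounded_op_fun R H K].
HB.instance Definition _ := gen_eqMixin 'B(H, K).
HB.instance Definition _ := gen_choiceMixin 'B(H, K).
HB.instance Definition _ :=
  [SubChoice_isSubLmodule of 'B(H, K) by <:].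

Lemma bounded_op_linear (x : 'B(H, K)) : linear x.
Proof. by have /asboolP[] := bounded_opP x. Qed.

Lemma bounded_op_continuous (x : 'B(H, K)) : continuous x.
Proof. by have /asboolP[] := bounded_opP x. Qed.

HB.instance Definition _ (x : 'B(H, K)) :=
  GRing.isLinear.Build R[i] H K _ x (bounded_op_linear x).

End BoundedOpLmodule.

Section OperatorAlgebra.
Context {R : realType}.
Implicit Types H K E : hilbertType R.

Lemma id_bounded_linear H : (@idfun H) \in bounded_linear.
Proof. by apply/asboolP; split => // x. Qed.

Definition idop {H} : 'B(H) := BoundedOp (id_bounded_linear H).

Lemma comp_bounded_linear H K E (x : 'B(K, E)) (y : 'B(H, K)) :
  (x \o y) \in bounded_linear.
Proof.
apply/asboolP; split; first by move=> a u v /=; rewrite !linearP.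
by move=> u; apply: continuous_comp; exact: bounded_op_continuous.
Qed.

Definition compop {H K E} (x : 'B(K, E)) (y : 'B(H, K)) : 'B(H, E) :=
  BoundedOp (comp_bounded_linear x y).

(* The Riesz theorem gives existence and uniqueness of the adjoint; the default
   value [0] is never used. *)
Definition adjop {H K} (x : 'B(H, K)) : 'B(K, H) :=
  xget 0 [set z : 'B(K, H) | forall xi eta, inner (z eta) xi = inner eta (x xi)].

End OperatorAlgebra.

Notation "x ∘ y" := (compop x y) (at level 40, left associativity) : ring_scope.
Notation "x ^†" := (adjop x) (at level 2, format "x ^†") : ring_scope.

(* The weak* topology of B(H, K), i.e. the topology of pointwise convergence on
   the predual. The elements of the predual (the trace-class operators from K to
   H) are the functionals x |-> \sum_n (eta_n | x xi_n) with xi, eta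
   square-summable. *)
Section WeakStarTopology.
Context {R : realType} (H K : hilbertType R).

Definition square_summable (E : hilbertType R) (xi : nat -> E) :=
  cvgn (series (fun n => `|xi n| ^+ 2 : R[i]^o)).

Definition predual_index :=
  {p : (nat -> H) * (nat -> K) | square_summable p.1 /\ square_summable p.2}.

Definition predual_pairing (x : 'B(H, K)) : {ptws predual_index -> R[i]^o} :=
  fun p => limn (series (fun n => inner ((sval p).2 n) (x ((sval p).1 n)) : R[i]^o)).

HB.instance Definition _ :=
  Topological.copy 'B(H, K) (initial_topology predual_pairing).

End WeakStarTopology.

Definition subspace {C : pzRingType} {V : lmodType C} (A : set V) :=
  A 0 /\ forall (a : C) x y, A x -> A y -> A (a *: x + y).

Definition lin {C : pzRingType} {V : lmodType C} (A : set V) : set V :=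
  smallest subspace A.

Section VonNeumannAlgebras.
Context {R : realType}.
Implicit Types H K : hilbertType R.

Definition commutant {H} (M : set 'B(H)) : set 'B(H) :=
  [set a | forall x, M x -> a ∘ x = x ∘ a].

Record von_neumann_algebra {H} (M : set 'B(H)) : Prop := {
  vN_subspace : subspace M ;
  vN_unit : M idop ;
  vN_comp : forall x y, M x -> M y -> M (x ∘ y) ;
  vN_adj : forall x, M x -> M x^† ;
  vN_closed : closed M }.

Record quantum_relation {H K} (M : set 'B(H)) (N : set 'B(K))
    (V : set 'B(H, K)) : Prop := {
  qrel_subspace : subspace V ;
  qrel_closed : closed V ;
  qrel_bimodule : forall a x b, commutant N a -> V x -> commutant M b ->
    V (a ∘ x ∘ b) }.

(* A matrix over B(H) is positive as an operator on the n-fold sum of H. *)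
Definition positive_opmx {H} n (A : 'M['B(H)]_n) :=
  forall xi : 'I_n -> H, 0 <= \sum_i \sum_j inner (xi i) (A i j (xi j)).

Definition linear_on {H K} (N : set 'B(K)) (f : 'B(K) -> 'B(H)) :=
  forall (a : R[i]) x y, N x -> N y -> f (a *: x + y) = a *: f x + f y.

(* Maps defined on N are encoded by total functions, all of whose properties
   are relative to N. *)
Record normal_cp {H K} (N : set 'B(K)) (M : set 'B(H)) (theta : 'B(K) -> 'B(H)) :
    Prop := {
  ncp_fun : forall y, N y -> M (theta y) ;
  ncp_linear : linear_on N theta ;
  ncp_normal : {within N, continuous theta} ;
  ncp_positive : forall n (A : 'M['B(K)]_n), (forall i j, N (A i j)) ->
    positive_opmx A -> positive_opmx (map_mx theta A) }.

Record normal_star_hom {H K} (N : set 'B(K)) (pi : 'B(K) -> 'B(H)) : Prop := {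
  nsh_linear : linear_on N pi ;
  nsh_unit : pi idop = idop ;
  nsh_comp : forall x y, N x -> N y -> pi (x ∘ y) = pi x ∘ pi y ;
  nsh_adj : forall x, N x -> pi x^† = (pi x)^† ;
  nsh_normal : {within N, continuous pi} }.

Record minimal_dilation {H K H0} (N : set 'B(K)) (theta : 'B(K) -> 'B(H))
    (pi0 : 'B(K) -> 'B(H0)) (v0 : 'B(H, H0)) : Prop := {
  mdil_hom : normal_star_hom N pi0 ;
  mdil_dilates : forall y, N y -> theta y = v0^† ∘ pi0 y ∘ v0 ;
  mdil_dense : dense (lin [set pi0 y (v0 xi) | y in N & xi in [set: H]]) }.

Definition intertwiners {K H0} (N : set 'B(K)) (pi0 : 'B(K) -> 'B(H0)) :
    set 'B(H0, K) :=
  [set x | forall y, N y -> y ∘ x = x ∘ pi0 y].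

End VonNeumannAlgebras.

(* A model of the Hilbert space tensor product of K and L, which is unique up to
   a unique unitary intertwining the maps [tens]. *)
Record hilbert_tensor (R : realType) (K L : hilbertType R) := HilbertTensor {
  tensor_space :> hilbertType R ;
  tens : K -> L -> tensor_space ;
  tens_linearl : forall l, linear (tens^~ l) ;
  tens_linearr : forall k, linear (tens k) ;
  tens_inner : forall k l k' l',
    inner (tens k l) (tens k' l') = inner k k' * inner l l' ;
  tens_dense : dense (lin [set tens k l | k in [set: K] & l in [set: L]]) }.

Section TensorOperators.
Context {R : realType} {H K L : hilbertType R} (T : hilbert_tensor K L).

(* Bounded operators on the tensor product are determined by their values on the
   elementary tensors, so the two sets below are singletons; the default value
   [0] is never used. *)

Definition tensor_id (y : 'B(K)) : 'B(T) :=
  xget 0 [set z : 'B(T) | forall k l, z (tens T k l) = tens T (y k) l].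

(* 1 ⊗ <xi|, with values in K after the identification of K ⊗ C with K. *)
Definition id_tensor_bra (xi : L) : 'B(T, K) :=
  xget 0 [set z : 'B(T, K) | forall k l, z (tens T k l) = inner xi l *: k].

Definition dilates (N : set 'B(K)) (theta : 'B(K) -> 'B(H)) (v : 'B(H, T)) :=
  forall y, N y -> theta y = v^† ∘ tensor_id y ∘ v.

Definition relation_of (N : set 'B(K)) (v : 'B(H, T)) : set 'B(H, K) :=
  closure (lin [set y' ∘ id_tensor_bra xi ∘ v |
                xi in [set: L] & y' in commutant N]).

End TensorOperators.

(* Main.v *)
Require Import Defs.
From HB Require Import structures.
From mathcomp Require Import all_boot all_order all_algebra.
From mathcomp Require Import complex.
From mathcomp Require Import all_classical all_reals all_analysis.
From mathcomp Require Import ring.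

Set Implicit Arguments.
Unset Strict Implicit.
Unset Printing Implicit Defensive.

Import Order.TTheory GRing.Theory Num.Theory Num.Def.
Import numFieldNormedType.Exports.

Local Open Scope classical_set_scope.
Local Open Scope ring_scope.

(** For a representation pi of N on E, call z : E -> K an intertwiner of pi if
    y z = z pi(y) for all y in N. Everything follows from describing the relation
    by intertwiners of y |-> y ⊗ 1 on K ⊗ L: the relation of v is the weak* closure
    of the set of all products z v with z such an intertwiner ([relation_ofE]). One inclusion holds because
    y' (1 ⊗ <xi|) intertwines when y' is in N'. For the other one, let P be the
    projection on the span of a finite orthonormal family e of L. Then
    z (1 ⊗ P) = sum over a in e of z_a (1 ⊗ <a|), where z_a = z (- ⊗ a) is
    in N'. By Gram-Schmidt the families e are cofinal, the projections 1 ⊗ P are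
    contractions tending strongly to 1, and a dominated convergence argument on
    the series that define the predual makes z (1 ⊗ P) v tend weak* to z v.

    Suppose now that (pi, v) and (rho, w) are representations with operators on H
    such that |sum_i rho(y_i) w xi_i| <= c |sum_i pi(y_i) v xi_i| for all finite
    sums. Then some bounded u satisfies u pi(y) = rho(y) u and u v = w
    ([orbit_sum_intertwiner]), so every product x w with x an intertwiner of rho
    is (x u) v with x u an intertwiner of pi. This is used twice.

    - If both pairs dilate theta, both sums have the same norm, which depends on
      theta alone. Hence the sets of products coincide for all dilations of theta.
      This gives the independence of (L, v) and the comparison with a minimal
      dilation at once, without constructing one.

    - If w = v b with b in M', the inequality holds since b and its adjoint commute
      with theta(N) ([commuting_orbit_bound]). So the set of products is stable
      under right multiplication by M', and it is clearly a left N'-module. Both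
      facts pass to the weak* closure because x |-> a x b is weak* continuous.

    The operator u and every adjoint come from one Riesz theorem, stated for
    bounded linear relations with arbitrary domains
    ([riesz_relation], [relation_adjoint]). It represents functionals by vectors
    in the double orthogonal complement of the domain, so that orthogonal
    decompositions never have to be formed. *)

(** * Inner products *)

Section InnerProduct.
Context {R : realType}.
Implicit Types H : hilbertType R.

Lemma innerDr H (x y z : H) : inner x (y + z) = inner x y + inner x z.
Proof. by rewrite /inner linearDl. Qed.

Lemma innerDl H (x y z : H) : inner (x + y) z = inner x z + inner y z.
Proof. by rewrite /inner linearDr. Qed.

Lemma innerZr H (a : R[i]) (x y : H) : inner x (a *: y) = a * inner x y.
Proof. by rewrite /inner linearZl_LR. Qed.

Lemma innerZl H (a : R[i]) (x y : H) : inner (a *: x) y = a^* * inner x y.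
Proof. by rewrite /inner linearZr_LR. Qed.

Lemma inner0r H (x : H) : inner x 0 = 0.
Proof. by rewrite -(scale0r (0 : H)) innerZr mul0r. Qed.

Lemma inner0l H (x : H) : inner 0 x = 0.
Proof. by rewrite -(scale0r (0 : H)) innerZl rmorph0 mul0r. Qed.

Lemma innerNr H (x y : H) : inner x (- y) = - inner x y.
Proof. by rewrite -scaleN1r innerZr mulN1r. Qed.

Lemma innerNl H (x y : H) : inner (- x) y = - inner x y.
Proof. by rewrite -scaleN1r innerZl rmorphN1 mulN1r. Qed.

Lemma innerBr H (x y z : H) : inner x (y - z) = inner x y - inner x z.
Proof. by rewrite innerDr innerNr. Qed.

Lemma innerBl H (x y z : H) : inner (x - y) z = inner x z - inner y z.
Proof. by rewrite innerDl innerNl. Qed.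

Lemma inner_sumr H I (r : seq I) (P : pred I) (F : I -> H) (x : H) :
  inner x (\sum_(i <- r | P i) F i) = \sum_(i <- r | P i) inner x (F i).
Proof. by rewrite /inner linear_sumlz. Qed.

Lemma inner_suml H I (r : seq I) (P : pred I) (F : I -> H) (x : H) :
  inner (\sum_(i <- r | P i) F i) x = \sum_(i <- r | P i) inner (F i) x.
Proof. by rewrite /inner raddf_sum. Qed.

Lemma inner_conj H (x y : H) : (inner x y)^* = inner y x.
Proof. by rewrite /inner [in RHS]hermC expr0 mul1r. Qed.

Lemma innerxx H (x : H) : inner x x = `|x| ^+ 2.
Proof. exact: hform_norm. Qed.

Lemma inner_eq0 H (x : H) : inner x x = 0 -> x = 0.
Proof. by move/eqP; rewrite innerxx sqrf_eq0 normr_eq0 => /eqP. Qed.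

Lemma inner_inj H (x y : H) : (forall z, inner z x = inner z y) -> x = y.
Proof.
move=> xy; apply/eqP; rewrite -subr_eq0; apply/eqP/inner_eq0.
by rewrite innerBr xy subrr.
Qed.

Lemma normD_sqr H (x y : H) :
  `|x + y| ^+ 2 = `|x| ^+ 2 + inner x y + inner y x + `|y| ^+ 2.
Proof. by rewrite -!innerxx innerDl !innerDr !addrA. Qed.

(** Cauchy-Schwarz: expand the squared norm of |x|^2 y - <x, y> x. *)
Lemma inner_norm_le H (x y : H) : `|inner x y| <= `|x| * `|y|.
Proof.
have [->|x0] := eqVneq x 0; first by rewrite inner0l !normr0 mul0r.
have nx0 : 0 < `|x| by rewrite normr_gt0.
(* |x|^2 times the component of y orthogonal to x. *)
pose z := `|x| ^+ 2 *: y - inner x y *: x.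
have cn : (`|x| ^+ 2)^* = `|x| ^+ 2 :> R[i].
  by rewrite -innerxx inner_conj.
have : 0 <= inner z z by rewrite innerxx exprn_ge0.
have -> : inner z z =
    `|x| ^+ 2 * (`|x| ^+ 2 * `|y| ^+ 2 - `|inner x y| ^+ 2).
  rewrite /z !(innerBl, innerBr, innerZl, innerZr) cn normCK !innerxx.
  by rewrite !inner_conj; ring.
rewrite pmulr_rge0 ?exprn_gt0// subr_ge0 -exprMn.
by rewrite ler_pXn2r// nnegrE ?mulr_ge0.
Qed.

Lemma eq0_norm_le_eps (a B : R[i]) : (forall e, 0 < e -> `|a| <= e * B) -> a = 0.
Proof.
move=> h; apply/eqP; rewrite -normr_le0; apply/ler_addgt0Pr => e e0.
rewrite add0r; have B0 : 0 <= B.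
  by rewrite -[B]mul1r; exact: le_trans (h 1 ltr01).
have B1 : 0 < B + 1 by rewrite ltr_wpDl.
apply: le_trans (h (e / (B + 1)) _) _; first by rewrite divr_gt0.
by rewrite mulrAC ler_pdivrMr// ler_pM2l// lerDl.
Qed.

(** The consequence of density that is used throughout: orthogonality to the set
    forces a vector to vanish. *)
Definition total_set H (D : set H) := forall x, (forall d, D d -> inner x d = 0) -> x = 0.

Lemma dense_total_set H (D : set H) : dense D -> total_set D.
Proof.
move=> dD x xD; apply/inner_eq0/(@eq0_norm_le_eps _ `|x|) => e e0.
have [d [xd Dd]] : ball x e `&` D !=set0.
  by apply: dD; [exists x; exact: ballxx|exact: ball_open].
rewrite -[X in inner _ X](subrK d) innerDr (xD d Dd) addr0.
apply: le_trans (inner_norm_le _ _) _.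
by rewrite mulrC ler_wpM2r//; move: xd; rewrite -ball_normE => /ltW.
Qed.

Lemma ortho_lin H (A : set H) x : (forall d, A d -> inner x d = 0) ->
  forall d, lin A d -> inner x d = 0.
Proof.
move=> xA d Ad; apply: (Ad [set d | inner x d = 0]); split=> //.
split=> [|a u v /= xu xv]; first exact: inner0r.
by rewrite innerDr innerZr xu xv mulr0 addr0.
Qed.

End InnerProduct.

(** * Riesz representation for bounded linear relations *)

Section Riesz.
Context {R : realType} {E K : hilbertType R}.
Variables (G : set (E * K)) (c : R[i]) (eta : K).
Hypothesis G_sub : Defs.subspace G.
Hypothesis c_ge0 : 0 <= c.
Hypothesis G_bound : forall p, G p -> `|p.2| <= c * `|p.1|.

Let G_scale a p : G p -> G (a *: p).
Proof. by case: G_sub => G0 GD Gp; by have := GD a p 0 Gp G0; rewrite addr0. Qed.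

(** The functional d |-> |d|^2 - 2 Re <eta, k>, for d related to k. A vector w
    representing k |-> <eta, k> on the domain would make it equal to
    |d - w|^2 - |w|^2, so minimizing sequences must converge to w. *)
Definition riesz_energy (p : E * K) : R[i] :=
  `|p.1| ^+ 2 - (inner eta p.2 + inner p.2 eta).

Lemma addr_conj_le (a : R[i]) : a + a^* <= `|a| *+ 2.
Proof.
have ar : a + a^* \is Num.real by rewrite CrealE rmorphD/= conjCK addrC.
apply: le_trans (real_ler_norm ar) (le_trans (ler_normD _ _) _).
by rewrite norm_conjC mulr2n.
Qed.

Lemma riesz_energy_real p : riesz_energy p \is Num.real.
Proof.
rewrite /riesz_energy rpredB ?rpredX ?normr_real//.
by rewrite CrealE rmorphD/= !inner_conj addrC.
Qed.

Lemma riesz_energy_ge p : G p -> - (c * `|eta|) ^+ 2 <= riesz_energy p.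
Proof.
move=> Gp; rewrite -subr_ge0 opprK /riesz_energy.
have h : inner eta p.2 + inner p.2 eta <= (c * `|eta|) * `|p.1| *+ 2.
  rewrite -(inner_conj eta); apply: le_trans (addr_conj_le _) _.
  rewrite lerMn2r/=; apply: le_trans (inner_norm_le _ _) _.
  by rewrite mulrC mulrAC; apply: ler_wpM2r => //; exact: G_bound.
apply: (@le_trans _ _ ((`|p.1| - c * `|eta|) ^+ 2)).
  rewrite real_exprn_even_ge0// rpredB ?normr_real// rpredM ?normr_real//.
  exact: ger0_real.
have -> : (`|p.1| - c * `|eta|) ^+ 2 =
  `|p.1| ^+ 2 - (c * `|eta|) * `|p.1| *+ 2 + (c * `|eta|) ^+ 2 by ring.
by rewrite lerD2r lerD2l lerN2.
Qed.

Lemma riesz_energy_inf : exists m : R[i],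
  (forall p, G p -> m <= riesz_energy p) /\
  (forall e : R[i], 0 < e -> exists2 p, G p & riesz_energy p < m + e).
Proof.
pose B := [set complex.Re (riesz_energy p) | p in G].
have ReE p : (complex.Re (riesz_energy p))%:C%C = riesz_energy p.
  exact/RRe_real/riesz_energy_real.
have Binf : has_inf B.
  split; first by exists (complex.Re (riesz_energy 0)), 0 => //; case: G_sub.
  exists (complex.Re (- (c * `|eta|) ^+ 2)) => _ [p Gp <-].
  by move: (riesz_energy_ge Gp); rewrite lecE => /andP[].
exists (inf B)%:C%C; split=> [p Gp|e e0].
  rewrite -ReE lecR; apply: ge_inf; first by case: Binf.
  by exists p.
have eE : (complex.Re e)%:C%C = e by exact/RRe_real/gtr0_real.
have e0' : 0 < complex.Re e by rewrite -ltcR eE.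
have [_ [p Gp <-] pe] := inf_adherent e0' Binf.
by exists p => //; rewrite -ReE -eE -rmorphD/= ltcR.
Qed.

(** Minimizing pairs have Cauchy first components by the parallelogram identity,
    the midpoint of two pairs being in the relation; completeness of E gives w. *)
Lemma riesz_energy_min : exists m (w : E),
  (forall p, G p -> m <= riesz_energy p) /\
  (forall e : R[i], 0 < e ->
    exists p, [/\ G p, riesz_energy p < m + e ^+ 2 & `|w - p.1| < e]).
Proof.
have [m [mJ Jm]] := riesz_energy_inf.
(* |p.1 - q.1|^2 = 2 J(p) + 2 J(q) - 4 J((p + q) / 2), where J is the energy. *)
have close p q e : 0 < e -> G p -> G q -> riesz_energy p < m + e ^+ 2 / 4 ->
    riesz_energy q < m + e ^+ 2 / 4 -> `|p.1 - q.1| < e.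
  move=> e0 Gp Gq pe qe.
  have Gpq : G (2^-1 *: (p + q)).
    apply: G_scale; case: G_sub => _ GD.
    by move: (GD 1 p q Gp Gq); rewrite scale1r.
  rewrite -(@ltr_pXn2r _ 2)// ?nnegrE ?(ltW e0)//.
  have -> : `|p.1 - q.1| ^+ 2 = (riesz_energy p + riesz_energy q) * 2
      - 4 * riesz_energy (2^-1 *: (p + q)).
    rewrite /riesz_energy /= normrZ exprMn -!innerxx innerBl !innerBr.
    rewrite innerZl innerZr !innerDl !innerDr.
    have -> : `|2^-1 : R[i]| = 2^-1 by rewrite ger0_norm.
    have -> : (2^-1 : R[i])^* = 2^-1 by rewrite conj_Creal// ger0_real.
    by field.
  apply: (@lt_le_trans _ _ ((m + e ^+ 2 / 4 + (m + e ^+ 2 / 4)) * 2 - 4 * m)).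
    rewrite ltr_leD ?lerN2 ?ler_pM2l ?mJ//.
    by rewrite ltr_pM2r// ltrD.
  by rewrite le_eqVlt; apply/orP; left; apply/eqP; field.
pose A (e : R[i]) : set E := [set p.1 | p in G `&` [set p | riesz_energy p < m + e]].
pose F := filter_from [set e : R[i] | 0 < e] A.
have FF : ProperFilter F.
  apply: filter_from_proper; last first.
    by move=> e /Jm[p Gp pe]; exists p.1, p.
  apply: filter_from_filter; first by exists 1; exact: ltr01.
  move=> e e' /= e0 e'0.
  have AS x y : x <= y -> A x `<=` A y.
    move=> xy _ [p [Gp px] <-]; exists p => //; split => //.
    by apply: lt_le_trans px _; rewrite lerD2l.
  have /orP[ee'|ee'] := real_comparable (gtr0_real e0) (gtr0_real e'0).
    by exists e => // x Ax; split => //; exact: AS ee' _ Ax.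
  by exists e' => // x Ax; split => //; exact: AS ee' _ Ax.
have Fc : cauchy F.
  apply: cauchy_exP => e e0.
  have e40 : 0 < e ^+ 2 / 4 by rewrite divr_gt0// exprn_gt0.
  have [p Gp pe] := Jm _ e40.
  exists p.1; exists (e ^+ 2 / 4) => // _ [q [Gq qe] <-].
  by rewrite -ball_normE; exact: close.
have /cvg_ex[w Fw] : cvg F by exact: cauchy_cvg.
exists m, w; split=> // e e0.
have Fw_ball : F (ball w e) by exact/Fw/nbhsx_ballx.
have FA : F (A (e ^+ 2)) by exists (e ^+ 2) => //; exact: exprn_gt0.
have [d [wb [p [Gp pe] pq]]] := filter_ex (filterI Fw_ball FA).
by exists p; split => //; move: wb; rewrite -pq -ball_normE.
Qed.

(** Riesz representation of the functional d |-> <eta, k> on the domain of a bounded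
    linear relation. The second clause places w in
    the double orthogonal complement of the domain, which makes w unique. *)
Lemma riesz_relation : exists w : E,
  [/\ forall p, G p -> inner w p.1 = inner eta p.2,
      forall x, (forall p, G p -> inner x p.1 = 0) -> inner x w = 0
    & `|w| <= c * `|eta|].
Proof.
have [m [w [mJ Jm]]] := riesz_energy_min.
have w_rep q : G q -> inner w q.1 = inner eta q.2.
  move=> Gq; apply/eqP; rewrite -subr_eq0; apply/eqP.
  pose A : R[i] := `|q.1| ^+ 2 + 1.
  have A1 : 1 <= A by rewrite lerDr exprn_ge0.
  have A0 : 0 < A := lt_le_trans ltr01 A1.
  apply: (@eq0_norm_le_eps _ _ (A + `|q.1|)) => e e0.
  have [p [Gp pe wp]] := Jm e e0.
  pose del := inner p.1 q.1 - inner eta q.2.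
  have -> : inner w q.1 - inner eta q.2 = del + inner (w - p.1) q.1.
    by rewrite /del innerBl; ring.
  apply: le_trans (ler_normD _ _) _; rewrite mulrDr lerD//; last first.
    by apply: le_trans (inner_norm_le _ _) _; rewrite ler_wpM2r// ltW.
  (* Up to the summand 1 in A, which avoids dividing by zero, t minimizes the
     energy on the line through p in the direction q. *)
  pose t := - del^* / A.
  have At : A^* = A by rewrite conj_Creal// gtr0_real.
  have Gpq : G (t *: q + p) by case: G_sub => _ GD; exact: GD.
  have := mJ _ Gpq.
  have -> : riesz_energy (t *: q + p) = riesz_energy p +
      (`|del| ^+ 2 * `|q.1| ^+ 2 / A ^+ 2 - `|del| ^+ 2 / A *+ 2).
    rewrite /riesz_energy /= normCK -!innerxx !(innerDl, innerDr, innerZl, innerZr).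
    rewrite /t !(rmorphM, rmorphN, fmorphV, conjCK)/= At.
    rewrite -(inner_conj p.1 q.1) -(inner_conj eta q.2) /del !rmorphB/= !conjCK.
    by field; rewrite gt_eqF.
  have qA : `|del| ^+ 2 * `|q.1| ^+ 2 / A ^+ 2 <= `|del| ^+ 2 / A.
    rewrite expr2 invfM mulrA ler_pM2r ?invr_gt0// ler_pdivrMr//.
    by rewrite ler_wpM2l// ?exprn_ge0// lerDl.
  move=> mle; have : `|del| ^+ 2 / A < e ^+ 2.
    rewrite -(ltrD2l m); apply: le_lt_trans pe.
    rewrite -lerBrDr; apply: le_trans mle _.
    by rewrite lerD2l mulr2n opprD addrA gerDr subr_le0.
  rewrite ltr_pdivrMr// => lt1.
  rewrite -(@ler_pXn2r _ 2)// ?nnegrE ?mulr_ge0 ?(ltW A0) ?(ltW e0)//.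
  apply: le_trans (ltW lt1) _; rewrite exprMn ler_wpM2l ?exprn_ge0 ?(ltW e0)//.
  by rewrite expr2 -[X in X <= _]mulr1 ler_wpM2l// ltW.
exists w; split=> [//|x xG|].
  apply: (@eq0_norm_le_eps _ _ `|x|) => e e0.
  have [p [Gp _ wp]] := Jm e e0.
  rewrite -[w](subrK p.1) innerDr xG// addr0.
  apply: le_trans (inner_norm_le _ _) _.
  by rewrite mulrC ler_wpM2r// ltW.
have [->|w0] := eqVneq w 0; first by rewrite normr0 mulr_ge0.
have nw0 : 0 < `|w| by rewrite normr_gt0.
rewrite -(ler_pM2r nw0) -expr2; apply/ler_addgt0Pr => e e0.
pose B := c * `|eta| + `|w| + 1.
have B0 : 0 < B by rewrite ltr_wpDl// addr_ge0// mulr_ge0.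
have eB : 0 < e / B by rewrite divr_gt0.
have [p [Gp _ wp]] := Jm _ eB.
have np : `|p.1| <= `|w| + e / B.
  have -> : p.1 = w - (w - p.1) by rewrite opprB addrC subrK.
  by apply: le_trans (ler_normB _ _) _; rewrite lerD2l ltW.
rewrite -innerxx -[X in inner _ X](subrK p.1) innerDr w_rep//.
apply: (@le_trans _ _ (`|w| * (e / B) + `|eta| * (c * (`|w| + e / B)))).
  have wr : inner w (w - p.1) + inner eta p.2 \is Num.real.
    by rewrite -w_rep// -innerDr subrK innerxx rpredX// normr_real.
  apply: le_trans (real_ler_norm wr) _; apply: le_trans (ler_normD _ _) _.
  rewrite lerD//; apply: le_trans (inner_norm_le _ _) _.
    by rewrite ler_wpM2l// ltW.
  rewrite ler_wpM2l//; apply: le_trans (G_bound Gp) _.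
  by rewrite ler_wpM2l.
have -> : `|w| * (e / B) + `|eta| * (c * (`|w| + e / B)) =
  c * `|eta| * `|w| + (e / B) * (c * `|eta| + `|w|) by ring.
rewrite lerD2l mulrAC ler_pdivrMr// ler_pM2l//.
by rewrite /B lerDl.
Qed.

End Riesz.

(** * Adjoints and operator calculus *)

Section Operators.
Context {R : realType}.
Implicit Types H K E : hilbertType R.

Lemma bounded_op_ext H K (x y : 'B(H, K)) : (forall xi, x xi = y xi) -> x = y.
Proof. by move=> xy; apply/val_inj/funext. Qed.

Lemma bounded_op_scaleD H K (a : R[i]) (x y : 'B(H, K)) xi :
  (a *: x + y) xi = a *: x xi + y xi.
Proof. by []. Qed.

Lemma bounded_op_bound H K (x : 'B(H, K)) :
  exists2 c : R[i], 0 < c & forall xi, `|x xi| <= c * `|xi|.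
Proof.
have /linear_boundedP : bounded_near x (nbhs (0 : H)).
  by apply/linear_bounded_continuous => ?; exact: bounded_op_continuous.
case=> c [cr cx]; exists (`|c| + 1); first by rewrite ltr_wpDl.
by apply: cx; rewrite (le_lt_trans (real_ler_norm cr))// ltrDl.
Qed.

Lemma linear_bound_bounded_linear H K (f : H -> K) (c : R[i]) :
  linear f -> (forall xi, `|f xi| <= c * `|xi|) -> f \in bounded_linear.
Proof.
move=> fl fc; apply/asboolP; split => //.
pose f' := HB.pack_for {linear H -> K} f (GRing.isLinear.Build _ _ _ _ f fl).
apply: (@bounded_linear_continuous _ _ _ f'); apply/linear_boundedP.
exists `|c|; split => [|r cr xi]; first exact: normr_real.
apply: le_trans (fc xi) _.
have [->|xi0] := eqVneq xi 0; first by rewrite normr0 !mulr0.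
have cr' : c \is Num.real.
  rewrite -(@mulfK _ `|xi| _ c) ?normr_eq0// rpredM ?rpredV ?normr_real//.
  by apply: ger0_real; exact: le_trans (fc xi).
by rewrite ler_wpM2r// (le_trans (real_ler_norm cr'))// ltW.
Qed.

(** The adjoint of a bounded linear relation is an everywhere defined bounded operator,
    linear by uniqueness of the Riesz vector. Applied to a graph it gives adjoints
    of operators; its own adjoint extends the relation to all of E. *)
Lemma relation_adjoint E K (G : set (E * K)) (c : R[i]) :
  Defs.subspace G -> 0 <= c -> (forall p, G p -> `|p.2| <= c * `|p.1|) ->
  exists z : 'B(K, E),
    (forall eta p, G p -> inner (z eta) p.1 = inner eta p.2) /\
    (forall eta x, (forall p, G p -> inner x p.1 = 0) -> inner x (z eta) = 0).
Proof.
move=> Gs c0 Gc.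
have /choice[f fP] := fun eta => riesz_relation eta Gs c0 Gc.
have fG eta p : G p -> inner (f eta) p.1 = inner eta p.2 by case: (fP eta) => + _ _; apply.
have fo eta x : (forall p, G p -> inner x p.1 = 0) -> inner x (f eta) = 0.
  by case: (fP eta) => _ + _; apply.
have fl : linear f.
  move=> a u v; apply/eqP; rewrite -subr_eq0; apply/eqP/inner_eq0.
  set d := _ - _; have dG p : G p -> inner d p.1 = 0.
    move=> Gp; rewrite /d innerBl innerDl innerZl !fG// innerDl innerZl.
    by rewrite subrr.
  by rewrite {2}/d innerBr innerDr innerZr !fo// mulr0 addr0 subrr.
have fc eta : `|f eta| <= c * `|eta| by case: (fP eta).
by exists (BoundedOp (linear_bound_bounded_linear fl fc)).
Qed.

Lemma adjopP H K (x : 'B(H, K)) xi eta : inner (x^† eta) xi = inner eta (x xi).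
Proof.
move: xi eta; rewrite /adjop.
case: xgetP => [z _ //|no]; exfalso.
have [c c0 xc] := bounded_op_bound x.
pose G : set (H * K) := [set p | p.2 = x p.1].
have Gs : Defs.subspace G.
  split=> [|a p q Gp Gq]; first by rewrite /G /= linear0.
  by rewrite /G/= Gp Gq linearP.
have [|z [zG _]] := relation_adjoint Gs (ltW c0); first by move=> p ->.
by apply: (no z) => xi eta; exact: (zG eta (xi, x xi)).
Qed.

Lemma adjopPr H K (x : 'B(H, K)) xi eta : inner xi (x^† eta) = inner (x xi) eta.
Proof. by rewrite -inner_conj adjopP inner_conj. Qed.

Lemma adjop_eq H K (x : 'B(H, K)) (z : 'B(K, H)) :
  (forall xi eta, inner xi (z eta) = inner (x xi) eta) -> x^† = z.
Proof.
move=> zP; apply: bounded_op_ext => eta; apply: inner_inj => xi.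
by rewrite adjopPr zP.
Qed.

Lemma adjopK H K (x : 'B(H, K)) : x^†^† = x.
Proof. by apply: adjop_eq => xi eta; rewrite adjopP. Qed.

Lemma adjop_comp H K E (x : 'B(K, E)) (y : 'B(H, K)) :
  (x ∘ y)^† = y^† ∘ x^†.
Proof. by apply: adjop_eq => xi eta /=; rewrite !adjopPr. Qed.

Lemma compopA H K E F (x : 'B(E, F)) (y : 'B(K, E)) (z : 'B(H, K)) :
  x ∘ (y ∘ z) = x ∘ y ∘ z.
Proof. exact: bounded_op_ext. Qed.

Lemma compop1 H K (x : 'B(H, K)) : x ∘ idop = x.
Proof. exact: bounded_op_ext. Qed.

Lemma comp1op H K (x : 'B(H, K)) : idop ∘ x = x.
Proof. exact: bounded_op_ext. Qed.

Lemma compopDr H K E (x : 'B(K, E)) (a : R[i]) (y z : 'B(H, K)) :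
  x ∘ (a *: y + z) = a *: (x ∘ y) + x ∘ z.
Proof. by apply: bounded_op_ext => xi; rewrite bounded_op_scaleD /= linearP. Qed.

Lemma compopDl H K E (x : 'B(H, K)) (a : R[i]) (y z : 'B(K, E)) :
  (a *: y + z) ∘ x = a *: (y ∘ x) + z ∘ x.
Proof. exact: bounded_op_ext. Qed.

(** The adjoints of x and y agree, their difference being orthogonal to D. *)
Lemma bounded_op_eq_total H K (D : set H) (x y : 'B(H, K)) :
  total_set D -> (forall d, D d -> x d = y d) -> x = y.
Proof.
move=> Dt xy; rewrite -[x]adjopK -[y]adjopK; congr adjop.
apply: bounded_op_ext => eta; apply/eqP; rewrite -subr_eq0; apply/eqP/Dt => d Dd.
by rewrite innerBl !adjopP xy// subrr.
Qed.

Lemma bounded_relation_extend E K (G : set (E * K)) (c : R[i]) :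
  Defs.subspace G -> 0 <= c -> (forall p, G p -> `|p.2| <= c * `|p.1|) ->
  exists u : 'B(E, K), forall p, G p -> u p.1 = p.2.
Proof.
move=> Gs c0 Gc; have [z [zG _]] := relation_adjoint Gs c0 Gc.
by exists z^† => p Gp; apply: inner_inj => eta; rewrite adjopPr zG.
Qed.

Lemma bounded_op_sum H K I (r : seq I) (F : I -> 'B(H, K)) xi :
  (\sum_(i <- r) F i) xi = \sum_(i <- r) F i xi.
Proof.
elim: r => [|i r IHr]; first by rewrite !big_nil.
by rewrite !big_cons -IHr.
Qed.

End Operators.

(** * Orthonormal families and the tensor product *)

Section GramSchmidt.
Context {R : realType} {L : hilbertType R}.
Implicit Types (e s : seq L) (l : L).

Definition ortho_proj e l : L := \sum_(a <- e) inner a l *: a.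

Lemma orthonormal_inner e a b : orthonormal (@hform R L) e ->
  a \in e -> b \in e -> inner a b = (a == b)%:R.
Proof. by move=> /orthonormalP[_ ee] ae be; rewrite /inner ee// eq_sym. Qed.

(** Stated with values in an arbitrary module to serve for vectors and for scalars. *)
Lemma orthonormal_sum e (V : lmodType R[i]) (F : L -> V) a :
  orthonormal (@hform R L) e -> a \in e ->
  \sum_(b <- e) inner a b *: F b = F a.
Proof.
move=> eo ae; have /orthonormalP[ue _] := eo.
rewrite (bigD1_seq a)//= (orthonormal_inner eo)// eqxx scale1r.
rewrite big_seq_cond big1 ?addr0// => b /andP[be ba].
by rewrite (orthonormal_inner eo)// eq_sym (negPf ba) scale0r.
Qed.

Lemma inner_ortho_proj e a l : orthonormal (@hform R L) e -> a \in e ->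
  inner a (ortho_proj e l) = inner a l.
Proof.
move=> eo ae; rewrite /ortho_proj inner_sumr.
rewrite -[RHS](orthonormal_sum (V := R[i]^o) (fun b => inner b l) eo ae).
by apply: eq_bigr => b _; rewrite innerZr mulrC.
Qed.

Lemma gram_schmidt s : exists e,
  orthonormal (@hform R L) e /\ {in s, forall l, ortho_proj e l = l}.
Proof.
elim: s => [|l s [e [eo es]]]; first by exists [::].
pose r := l - ortho_proj e l.
have er a : a \in e -> inner a r = 0.
  by move=> ae; rewrite /r innerBr inner_ortho_proj// subrr.
have [r0|r0] := eqVneq r 0.
  exists e; split => // x; rewrite inE => /predU1P[->|/es//].
  by apply/esym/eqP; rewrite -subr_eq0 -/r r0.
have nr0 : `|r| != 0 by rewrite normr_eq0.
pose u := `|r|^-1 *: r.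
have ue a : a \in e -> inner a u = 0.
  by move=> ae; rewrite /u innerZr er// mulr0.
have eu a : a \in e -> inner u a = 0.
  by move=> /ue ua; rewrite -inner_conj ua rmorph0.
have uu : inner u u = 1.
  rewrite innerxx /u normrZ ger0_norm ?invr_ge0// mulVf//.
  by rewrite expr1n.
have uNe : u \notin e.
  by apply/negP => /ue/eqP; rewrite uu oner_eq0.
exists (u :: e); split.
  have /orthonormalP[eU eE] := eo.
  apply/orthonormalP; split; first by rewrite /= uNe.
  move=> a b; rewrite !inE => /predU1P[->|ae] /predU1P[->|be].
  - by rewrite eqxx; exact: uu.
  - by rewrite [LHS]ue//; case: eqVneq uNe => // ->; rewrite be.
  - by rewrite [LHS]eu//; case: eqVneq uNe => // <-; rewrite ae.
  - exact: eE.
have up x : inner u (ortho_proj e x) = 0.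
  rewrite /ortho_proj inner_sumr big_seq big1// => a ae.
  by rewrite innerZr eu// mulr0.
move=> x; rewrite inE /ortho_proj big_cons -/(ortho_proj e x).
move=> /predU1P[->|/es ex]; last by rewrite ex -[in inner u x]ex up scale0r add0r.
have -> : inner u l = `|r|.
  rewrite -[l](subrK (ortho_proj e l)) innerDr up addr0 -/r.
  have -> : r = `|r| *: u by rewrite /u scalerA divff// scale1r.
  by rewrite innerZr uu mulr1 normrZ normr_id -[LHS]mulr1; congr (_ * _);
    apply/eqP; rewrite eq_sym -sqrp_eq1// -innerxx uu.
by rewrite /u scalerA divff// scale1r /r subrK.
Qed.

End GramSchmidt.

Section Tensor.
Context {R : realType} {K L : hilbertType R} (T : hilbert_tensor K L).
Implicit Types (e s : seq L) (k : K) (l : L).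

Lemma tens_norm k l : `|tens T k l| = `|k| * `|l|.
Proof.
apply/eqP; rewrite -(@eqrXn2 _ 2)// ?mulr_ge0//.
by rewrite exprMn -!innerxx tens_inner.
Qed.

Lemma tens_right_bounded l : tens T ^~ l \in bounded_linear.
Proof.
apply: (linear_bound_bounded_linear (c := `|l|)); first exact: tens_linearl.
by move=> k; rewrite tens_norm mulrC.
Qed.

Definition tens_right l : 'B(K, T) := BoundedOp (tens_right_bounded l).

Lemma tens_left_bounded k : tens T k \in bounded_linear.
Proof.
apply: (linear_bound_bounded_linear (c := `|k|)); first exact: tens_linearr.
by move=> l; rewrite tens_norm.
Qed.

Definition tens_left k : 'B(L, T) := BoundedOp (tens_left_bounded k).

Lemma tensZl (a : R[i]) k l : tens T (a *: k) l = a *: tens T k l.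
Proof. by rewrite -[LHS]/(tens_right l _) linearZ. Qed.

Lemma tensZr (a : R[i]) k l : tens T k (a *: l) = a *: tens T k l.
Proof. by rewrite -[LHS]/(tens_left k _) linearZ. Qed.

Lemma tens_suml I (r : seq I) (F : I -> K) l :
  tens T (\sum_(i <- r) F i) l = \sum_(i <- r) tens T (F i) l.
Proof. by rewrite -[LHS]/(tens_right l _) linear_sum. Qed.

Lemma tens_sumr I (r : seq I) k (F : I -> L) :
  tens T k (\sum_(i <- r) F i) = \sum_(i <- r) tens T k (F i).
Proof. by rewrite -[LHS]/(tens_left k _) linear_sum. Qed.

Lemma tens_total : total_set [set tens T k l | k in [set: K] & l in [set: L]].
Proof.
by move=> t tT; apply: (dense_total_set (@tens_dense _ _ _ T)); exact: ortho_lin.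
Qed.

Lemma tens_ext (E : hilbertType R) (x y : 'B(T, E)) :
  (forall k l, x (tens T k l) = y (tens T k l)) -> x = y.
Proof.
move=> xy; apply: (bounded_op_eq_total tens_total).
by move=> _ [k _ [l _ <-]].
Qed.

Lemma adj_tens_right a k l : (tens_right a)^† (tens T k l) = inner a l *: k.
Proof.
apply: inner_inj => h; rewrite adjopPr /= tens_inner innerZr mulrC.
by [].
Qed.

Lemma id_tensor_braE a : id_tensor_bra T a = (tens_right a)^†.
Proof.
rewrite /id_tensor_bra; case: xgetP => [z _ zP|/(_ (tens_right a)^†)[]].
  by apply: tens_ext => k l; rewrite zP adj_tens_right.
exact: adj_tens_right.
Qed.

(** A finite sum of elementary tensors can be rewritten along an orthonormal family
    of L, simultaneously for all operators x on the left leg. *)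
Lemma tens_sum_orthonormal e (s : seq (K * L)) (x : 'B(K)) :
  {in [seq q.2 | q <- s], forall l, ortho_proj e l = l} ->
  \sum_(q <- s) tens T (x q.1) q.2 =
  \sum_(a <- e) tens T (x (\sum_(q <- s) inner a q.2 *: q.1)) a.
Proof.
move=> es; under [RHS]eq_bigr do rewrite linear_sum tens_suml.
rewrite exchange_big/=; apply: eq_big_seq => q qs.
rewrite -{1}(es q.2) ?map_f// tens_sumr; apply: eq_bigr => a _.
by rewrite linearZ tensZl tensZr.
Qed.

Lemma tens_orthonormal_norm e (g : L -> K) : orthonormal (@hform R L) e ->
  `|\sum_(a <- e) tens T (g a) a| ^+ 2 = \sum_(a <- e) `|g a| ^+ 2.
Proof.
move=> eo; rewrite -innerxx inner_suml; apply: eq_big_seq => a ae.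
rewrite inner_sumr -innerxx.
rewrite -[RHS](orthonormal_sum (V := R[i]^o) (fun b => inner (g a) (g b)) eo ae).
by apply: eq_bigr => b _; rewrite tens_inner mulrC.
Qed.

(** Boundedness of y ⊗ 1 on finite sums is clear once the right legs are orthonormal,
    because the norm is then a sum of squares; Gram-Schmidt reduces to that case. *)
Lemma tensor_idE (y : 'B(K)) k l : tensor_id T y (tens T k l) = tens T (y k) l.
Proof.
move: k l; rewrite /tensor_id; case: xgetP => [z _ //|no]; exfalso.
have [c c0 yc] := bounded_op_bound y.
pose G : set (T * T) := [set p | exists s : seq (K * L),
  p.1 = \sum_(q <- s) tens T q.1 q.2 /\ p.2 = \sum_(q <- s) tens T (y q.1) q.2].
have Gs : Defs.subspace G.
  split=> [|a p p' [s [p1 p2]] [s' [p1' p2']]]; first by exists [::]; rewrite !big_nil.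
  exists ([seq (a *: q.1, q.2) | q <- s] ++ s').
  rewrite !big_cat !big_map /= p1 p2 p1' p2' !scaler_sumr; split; congr (_ + _);
    by apply: eq_bigr => q _; rewrite ?linearZ tensZl.
have Gc p : G p -> `|p.2| <= c * `|p.1|.
  move=> [s [-> ->]]; have [e [eo es]] := gram_schmidt [seq q.2 | q <- s].
  rewrite (tens_sum_orthonormal y es).
  have -> := tens_sum_orthonormal (@idop _ K) es.
  rewrite -(@ler_pXn2r _ 2)// ?nnegrE ?mulr_ge0 ?(ltW c0)//.
  rewrite exprMn !tens_orthonormal_norm// mulr_sumr.
  apply: ler_sum => a _; rewrite -exprMn ler_pXn2r ?nnegrE ?mulr_ge0 ?(ltW c0)//.
have [u uG] := bounded_relation_extend Gs (ltW c0) Gc.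
apply: (no u) => k l; apply: (uG (tens T k l, tens T (y k) l)).
by exists [:: (k, l)]; rewrite !big_seq1.
Qed.

Lemma tensor_id1 : tensor_id T idop = idop.
Proof. by apply: tens_ext => k l; rewrite tensor_idE. Qed.

Lemma tensor_id_comp (x y : 'B(K)) :
  tensor_id T (x ∘ y) = tensor_id T x ∘ tensor_id T y.
Proof. by apply: tens_ext => k l; rewrite /= !tensor_idE. Qed.

Lemma tensor_id_adj (x : 'B(K)) : tensor_id T x^† = (tensor_id T x)^†.
Proof.
apply: tens_ext => k l; rewrite tensor_idE.
apply/eqP; rewrite -subr_eq0; apply/eqP/tens_total => _ [k' _ [l' _ <-]].
by rewrite innerBl adjopP tensor_idE !tens_inner adjopP subrr.
Qed.

(** The operator 1 ⊗ P, with P the projection on the span of e, when e is orthonormal. *)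
Definition tens_proj e : 'B(T) :=
  \sum_(a <- e) (tens_right a ∘ (tens_right a)^†).

Lemma tens_projE e t :
  tens_proj e t = \sum_(a <- e) tens T ((tens_right a)^† t) a.
Proof. by rewrite /tens_proj bounded_op_sum. Qed.

Lemma tens_proj_tens e k l : ortho_proj e l = l ->
  tens_proj e (tens T k l) = tens T k l.
Proof.
move=> el; rewrite tens_projE -[in RHS]el tens_sumr; apply: eq_bigr => a _.
by rewrite adj_tens_right tensZl tensZr.
Qed.

(** The complement of a projection is a contraction. *)
Lemma tens_projC_norm e t : orthonormal (@hform R L) e ->
  `|t - tens_proj e t| <= `|t|.
Proof.
move=> eo; rewrite -(@ler_pXn2r _ 2)// ?nnegrE//.
have tQ : inner t (tens_proj e t) = `|tens_proj e t| ^+ 2.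
  rewrite tens_projE tens_orthonormal_norm// inner_sumr; apply: eq_bigr => a _.
  by rewrite -innerxx adjopP.
have Qt : inner (tens_proj e t) t = `|tens_proj e t| ^+ 2.
  by rewrite -inner_conj tQ -innerxx inner_conj.
rewrite normD_sqr normrN innerNr innerNl tQ Qt addrNK.
by rewrite gerBl exprn_ge0.
Qed.

Lemma tens_proj_cvg t (eps : R[i]) : 0 < eps -> exists s, forall e,
  orthonormal (@hform R L) e -> {in s, forall l, ortho_proj e l = l} ->
  `|t - tens_proj e t| < eps.
Proof.
move=> eps0; have [d [td Ld]] : ball t eps `&`
    lin [set tens T k l | k in [set: K] & l in [set: L]] !=set0.
  by apply: (@tens_dense _ _ _ T); [exists t; exact: ballxx|exact: ball_open].
pose P (d : T) := exists s, forall e, {in s, forall l, ortho_proj e l = l} ->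
  tens_proj e d = d.
have [s sd] : P d.
  apply: (Ld P); split.
    split=> [|a x y [sx xP] [sy yP]]; first by exists [::] => e _; rewrite linear0.
    exists (sx ++ sy) => e es; rewrite bounded_op_linear (xP e) ?(yP e)// => l ls;
      by apply: es; rewrite mem_cat ls ?orbT.
  move=> _ [k _ [l _ <-]]; exists [:: l] => e es.
  by rewrite tens_proj_tens// es// inE.
exists s => e eo es.
have -> : t - tens_proj e t = (t - d) - tens_proj e (t - d).
  by rewrite linearB/= sd// opprB addrA subrK.
by apply: le_lt_trans (tens_projC_norm _ eo) _; move: td; rewrite -ball_normE.
Qed.

End Tensor.

(** * Scalar series *)

Section ScalarSeries.
Context {R : realType}.

Lemma complex_norm_le (z : R[i]) :
  `|z| <= (`|complex.Re z| + `|complex.Im z|)%:C%C.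
Proof.
rewrite {1}[z]complexE; apply: le_trans (ler_normD _ _) _.
rewrite normrM !normc_def /= !expr0n /= !expr1n !add0r !addr0 sqrtr1 !sqrtr_sqr.
by rewrite mul1r rmorphD.
Qed.

Lemma norm_Im_le (z : R[i]) : `|complex.Im z|%:C%C <= `|z|.
Proof. by rewrite normc_def lecR -sqrtr_sqr ler_wsqrtr// lerDr sqr_ge0. Qed.

(** Real and imaginary parts are 1-Lipschitz, so completeness reduces to that of R. *)
Lemma complex_complete (F : set_system R[i]^o) :
  ProperFilter F -> cauchy F -> cvg F.
Proof.
move=> FF /cauchyP Fc.
have part (f : R[i]^o -> R) : {morph f : x y / x - y} ->
    (forall z, `|f z|%:C%C <= `|z|) -> exists l : R, f z @[z --> F] --> l.
  move=> fB fle; apply/cvg_ex/(@cauchy_cvg _ (f z @[z --> F])).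
  apply: cauchy_exP => e e0.
  have e0' : (0 : R[i]) < e%:C%C by rewrite ltcR.
  have [z Fz] := Fc _ e0'; exists (f z).
  rewrite /fmap /=; apply: (@filterS _ F _ _ _ _ Fz) => t.
  rewrite /= -!ball_normE /= => zt.
  by rewrite -ltcR -fB; exact: le_lt_trans (fle _) zt.
have [a Fa] := part (@complex.Re R) (fun x y => raddfB _ x y) (@normc_ge_Re R).
have [b Fb] := part (@complex.Im R) (fun x y => raddfB _ x y) norm_Im_le.
apply/cvg_ex; exists (a +i* b)%C; apply/cvgrPdist_lt => e e0.
have eE : (complex.Re e)%:C%C = e by exact/RRe_real/gtr0_real.
have e2 : 0 < complex.Re e / 2 by rewrite divr_gt0// -ltcR eE.
near=> z; rewrite -eE [complex.Re e]splitr.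
apply: le_lt_trans (complex_norm_le _) _; rewrite ltcR ltrD//.
  by rewrite (raddfB (@complex.Re R))/=; near: z; move/cvgrPdist_lt : Fa; apply.
by rewrite (raddfB (@complex.Im R))/=; near: z; move/cvgrPdist_lt : Fb; apply.
Unshelve. all: by end_near. Qed.

Lemma dominated_cvg_series (a b : nat -> R[i]^o) : (forall n, `|a n| <= b n) ->
  cvgn (series b) -> cvgn (series a).
Proof.
move=> ab bc; apply: complex_complete; apply/cauchy_seriesP => e e0.
have /cauchy_seriesP/(_ e e0) : cauchy (series b @ \oo) by exact: cvg_cauchy.
apply: filterS => -[m n]/=; apply: le_lt_trans.
apply: le_trans (ler_norm_sum _ _ _) _.
apply: (@le_trans _ _ (\sum_(m <= k < n) b k)); first exact: ler_sum.
apply: real_ler_norm; apply: rpred_sum => k _.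
by apply: ger0_real; exact: le_trans (ab k).
Qed.

Lemma series_tail_small (b : nat -> R[i]^o) (e : R[i]) : 0 < e ->
  cvgn (series b) -> exists N, forall n, (N <= n)%N ->
  `|\sum_(N <= k < n) b k| <= e.
Proof.
move=> e0 bc.
have /cauchy_seriesP/(_ e e0) : cauchy (series b @ \oo) by exact: cvg_cauchy.
case=> -[A B] /= [[i _ iA] [j _ jB]] AB; exists (maxn i j) => n ijn.
apply/ltW/(AB (maxn i j, n)); split => /=.
  by apply: iA; rewrite /= leq_maxl.
by apply: jB; rewrite /= (leq_trans _ ijn)// leq_maxr.
Qed.

(** Dominated convergence for series along a filter (Tannery): a tail of the dominating
    series bounds all tails, and finitely many terms remain. *)
Lemma dominated_lim_series (I : Type) (F : set_system I) (b : nat -> R[i]^o)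
    (a : I -> nat -> R[i]^o) : Filter F ->
  F [set i | forall n, `|a i n| <= b n] -> cvgn (series b) ->
  (forall n (e : R[i]), 0 < e -> F [set i | `|a i n| < e]) ->
  forall e : R[i], 0 < e -> F [set i | `|limn (series (a i))| < e].
Proof.
move=> FF ab bc a0 e e0.
have e30 : 0 < e / 4 by rewrite divr_gt0.
have [N Nb] := series_tail_small e30 bc.
have small M d : 0 < d -> F [set i | `|\sum_(0 <= k < M) a i k| < d].
  elim: M d => [|M IHM] d d0.
    by apply: filterS filterT => i _ /=; rewrite big_geq// normr0.
  have d2 : 0 < d / 2 by rewrite divr_gt0.
  apply: filterS2 (IHM _ d2) (a0 M _ d2) => i /= h1 h2.
  rewrite big_nat_recr//= [d]splitr; apply: le_lt_trans (ler_normD _ _) _.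
  exact: ltrD.
apply: filterS2 (small N _ e30) ab => i /= sm abi.
have ac : cvgn (series (a i)) by exact: dominated_cvg_series bc.
have /cvgrPdist_lt/(_ _ e30)[n0 _ n0P] := ac.
set n := maxn n0 N; have lim_n := n0P n (leq_maxl _ _).
have tail : `|\sum_(N <= k < n) a i k| <= e / 4.
  apply: le_trans (Nb n (leq_maxr _ _)).
  apply: le_trans (ler_norm_sum _ _ _) (le_trans _ (real_ler_norm _)).
    exact: ler_sum.
  apply: rpred_sum => k _.
  by apply: ger0_real; exact: le_trans (abi k).
rewrite -[limn _](subrK (series (a i) n)).
have split_n : series (a i) n =
    \sum_(0 <= k < N) a i k + \sum_(N <= k < n) a i k.
  by rewrite -big_cat_nat//= leq_maxr.
rewrite [X in _ + X]split_n.
apply: le_lt_trans (ler_normD _ _) _.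
apply: (@lt_le_trans _ _ (e / 4 + (e / 4 + e / 4))).
  apply: ltrD; first exact: lim_n.
  by apply: le_lt_trans (ler_normD _ _) _; rewrite ltr_leD.
by rewrite -subr_ge0 (_ : e - _ = e / 4) ?ltW//; field.
Qed.

End ScalarSeries.

(** * The weak* topology *)

Section Convergence.

Lemma initial_topology_cvgP (S : choiceType) (T : topologicalType) (f : S -> T)
    (F : set_system S) (s : S) : Filter F ->
  F --> (s : initial_topology f) <-> f @ F --> f s.
Proof.
move=> FF; split=> Fs.
  by apply: cvg_trans (cvg_app f Fs) _; exact: initial_continuous.
move=> A /= [_ [[B Bop <-] Bs sBA]].
by apply: (@filterS _ F _ _ _ sBA); apply: Fs; exact: open_nbhs_nbhs.
Qed.

Lemma product_topology_cvgP (U : Type) (V : topologicalType)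
    (F : set_system {ptws U -> V}) (f : {ptws U -> V}) : Filter F ->
  F --> f <-> forall u, g u @[g --> F] --> f u.
Proof.
move=> FF; split=> [/cvg_sup Ff u|Ff].
  by apply/(@initial_topology_cvgP _ _ (fun g : U -> V => g u)); exact: Ff.
apply/cvg_sup => u.
by apply/(@initial_topology_cvgP _ _ (fun g : U -> V => g u)); exact: Ff.
Qed.

End Convergence.

Section WeakStar.
Context {R : realType}.
Implicit Types H K E : hilbertType R.

Lemma cvg_scaleD (T : Type) (F : set_system T) {FF : Filter F} (a : R[i])
    (f g : T -> R[i]^o) (l m : R[i]^o) : f @ F --> l -> g @ F --> m ->
  (fun i => a *: f i + g i) @ F --> a *: l + m.
Proof.
move=> fl gm; have h := @cvgZl_tmp R[i] R[i]^o T F FF a f l fl.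
exact: (@cvgD R[i] R[i]^o T F FF _ _ _ _ h gm).
Qed.

(** A dominating series common to all operators of norm at most c, from
    |eta_n| c |xi_n| <= c^2 |xi_n|^2 + |eta_n|^2. *)
Lemma predual_term_le H K (c : R[i]) (p : predual_index H K) : 0 <= c ->
  exists2 b : nat -> R[i]^o, cvgn (series b) &
    forall (y : 'B(H, K)) n, (forall xi, `|y xi| <= c * `|xi|) ->
      `|inner ((sval p).2 n) (y ((sval p).1 n))| <= b n.
Proof.
case: p => -[xi eta] [/= sxi seta] c0.
exists (fun n => (c ^+ 2 * `|xi n| ^+ 2 + `|eta n| ^+ 2 : R[i]^o)).
  rewrite (_ : series _ =
    c ^+ 2 *: series (fun n => `|xi n| ^+ 2 : R[i]^o) +
    series (fun n => `|eta n| ^+ 2 : R[i]^o)); last first.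
    apply/funext => n; rewrite /series /= !fctE big_split/=; congr (_ + _).
    by rewrite scaler_sumr.
  apply: is_cvgD; last exact: seta.
  by apply: is_cvgZr; exact: sxi.
move=> y n yc; apply: le_trans (inner_norm_le _ _) _.
apply: (@le_trans _ _ (`|eta n| * (c * `|xi n|))); first by rewrite ler_wpM2l.
rewrite -exprMn; set a := `|eta n|; set d := c * _.
have a0 : 0 <= a by exact: normr_ge0.
have d0 : 0 <= d by apply: mulr_ge0 => //; exact: normr_ge0.
have : 0 <= (a - d) ^+ 2.
  by rewrite real_exprn_even_ge0// rpredB// ger0_real.
rewrite sqrrB addrAC subr_ge0 => h; rewrite addrC; apply: le_trans h.
by rewrite mulr2n lerDl mulr_ge0.
Qed.

Lemma predual_pairing_cvg H K (x : 'B(H, K)) (p : predual_index H K) :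
  cvgn (series (fun n => inner ((sval p).2 n) (x ((sval p).1 n)) : R[i]^o)).
Proof.
have [c c0 xc] := bounded_op_bound x.
have [b bc xb] := predual_term_le p (ltW c0).
by apply: dominated_cvg_series bc => n; apply: xb.
Qed.

Lemma predual_pairingP H K (a : R[i]) (x y : 'B(H, K)) (p : predual_index H K) :
  predual_pairing (a *: x + y) p = a * predual_pairing x p + predual_pairing y p.
Proof.
have xp := @predual_pairing_cvg H K x p.
have yp := @predual_pairing_cvg H K y p.
rewrite /predual_pairing.
set sx := series _ in xp *; set sy := series _ in yp *.
have -> : series (fun n => inner ((sval p).2 n) ((a *: x + y) ((sval p).1 n)) : R[i]^o) =
    (fun n => a *: sx n + sy n : R[i]^o).
  apply/funext => n; rewrite /sx /sy /series /= scaler_sumr -big_split/=.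
  by apply: eq_bigr => k _; rewrite innerDr innerZr.
have h := @cvg_lim R[i]^o (@norm_hausdorff _ R[i]^o) _ _ _ _ _ (cvg_scaleD (a := a) xp yp).
exact: h.
Qed.

Lemma weakstar_cvgP H K (F : set_system 'B(H, K)) (z : 'B(H, K)) : Filter F ->
  F --> z <-> forall p : predual_index H K,
    (predual_pairing x p : R[i]^o) @[x --> F] --> (predual_pairing z p : R[i]^o).
Proof.
move=> FF; set pp := @predual_pairing R H K; split=> [Fz|Fz].
  by apply/(@product_topology_cvgP _ _ (pp @ F))/initial_topology_cvgP.
by apply/(@initial_topology_cvgP _ _ pp)/product_topology_cvgP.
Qed.

Lemma weakstar_continuous H K H' K' (f : 'B(H, K) -> 'B(H', K')) :
  (forall p (z : 'B(H, K)), (predual_pairing (f x) p : R[i]^o) @[x --> z] -->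
    (predual_pairing (f z) p : R[i]^o)) -> continuous f.
Proof.
move=> fp z; have FF : Filter (f @ z) by apply: (@fmap_filter _ _ f (nbhs z)); exact: nbhs_filter.
by apply/(weakstar_cvgP _ FF) => p; exact: fp.
Qed.

Lemma predual_pairing_continuous H K (p : predual_index H K) (z : 'B(H, K)) :
  (predual_pairing x p : R[i]^o) @[x --> z] --> (predual_pairing z p : R[i]^o).
Proof. exact: (weakstar_cvgP z (nbhs_filter z)).1. Qed.

Lemma closure_map (S T : topologicalType) (f : S -> T) (A : set S) (B : set T) :
  continuous f -> (forall x, A x -> closure B (f x)) ->
  forall x, closure A x -> closure B (f x).
Proof.
move=> fc AB x Ax.
have fB : closed (f @^-1` closure B).
  by apply: closed_comp => [y _|]; [exact: fc|exact: closed_closure].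
by apply: fB; apply: closure_subset Ax => y /AB.
Qed.

Lemma closure_subspace H K (A : set 'B(H, K)) :
  Defs.subspace A -> Defs.subspace (closure A).
Proof.
case=> A0 AD; split; first exact: subset_closure.
have contl (a : R[i]) (y : 'B(H, K)) : continuous (fun x : 'B(H, K) => a *: x + y).
  apply: weakstar_continuous => p z; rewrite predual_pairingP.
  under eq_fun do rewrite predual_pairingP.
  exact: (cvg_scaleD (a := a) (@predual_pairing_continuous _ _ p z) (cvg_cst _)).
have contr (a : R[i]) (x : 'B(H, K)) : continuous (fun y : 'B(H, K) => a *: x + y).
  apply: weakstar_continuous => p z; rewrite predual_pairingP.
  under eq_fun do rewrite predual_pairingP.
  exact: (cvg_scaleD (a := a) (cvg_cst _) (@predual_pairing_continuous _ _ p z)).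
move=> a x y Ax Ay; move: x Ax; apply: (closure_map (contl a y)) => x Ax.
move: y Ay; apply: (closure_map (contr a x)) => y Ay.
by apply: subset_closure; exact: AD.
Qed.

Lemma square_summable_bounded H K (x : 'B(H, K)) (xi : nat -> H) :
  square_summable xi -> square_summable (x \o xi).
Proof.
move=> sxi; have [c c0 xc] := bounded_op_bound x.
apply: (@dominated_cvg_series _ _ (c ^+ 2 *: (fun n => `|xi n| ^+ 2 : R[i]^o))).
  move=> n; rewrite ger0_norm ?exprn_ge0//= fctE /= -[leRHS]exprMn.
  by rewrite ler_pXn2r ?nnegrE ?mulr_ge0// ltW.
rewrite (_ : series _ = c ^+ 2 *: series (fun n => `|xi n| ^+ 2 : R[i]^o)).
  by apply: is_cvgZr.
by apply/funext => n; rewrite /series /= !fctE scaler_sumr.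
Qed.

(** The predual is a bimodule: a functional given by (xi_n), (eta_n) is pulled back to
    the one given by (b xi_n), (a* eta_n). *)
Lemma compop_weakstar_continuous H K H' K' (a : 'B(K, K')) (b : 'B(H', H)) :
  continuous (fun x : 'B(H, K) => a ∘ x ∘ b).
Proof.
apply: weakstar_continuous => -[[xi eta] [/= sxi seta]] z.
pose q : predual_index H K := exist _ (b \o xi, a^† \o eta)
  (conj (square_summable_bounded (x := b) sxi) (square_summable_bounded (x := a^†) seta)).
have pq x : predual_pairing (a ∘ x ∘ b)
    (exist _ (xi, eta) (conj sxi seta)) = predual_pairing x q.
  rewrite /predual_pairing /=; congr (limn (series _)); apply/funext => n /=.
  by rewrite adjopP.
under eq_fun do rewrite pq.
by rewrite pq; exact: predual_pairing_continuous.
Qed.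

End WeakStar.

(** * Dilations and intertwining operators *)

Section SquaringGrowth.
Context {R : realType}.

Lemma bernoulli_le (q : R) n : 1 <= q -> 1 + (q - 1) *+ n <= q ^+ n.
Proof.
move=> q1; elim: n => [|n IHn]; first by rewrite mulr0n addr0 expr0.
rewrite exprS; apply: le_trans (ler_wpM2l (le_trans ler01 q1) IHn).
rewrite mulrDr mulr1 mulrSr addrA addrAC -lerBrDl.
have -> : q + q * ((q - 1) *+ n) - (1 + (q - 1)) = q * ((q - 1) *+ n) by ring.
by rewrite -[leLHS]mul1r ler_wpM2r// mulrn_wge0// subr_ge0.
Qed.

(** With q = r 1 / (c * r 0), iterated squaring gives r (2^k) >= r 0 * (q c)^(2^k),
    which contradicts r n <= C c^n for large k unless q <= 1. *)
Lemma squaring_growth_bound_real (r : nat -> R) (C c : R) : 0 < c -> (forall n, 0 <= r n) ->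
  (forall n, r n ^+ 2 <= r 0%N * r (n + n)%N) -> (forall n, r n <= C * c ^+ n) ->
  r 1%N <= c * r 0%N.
Proof.
move=> c0 r0 r2 rC; rewrite leNgt; apply/negP => lt1.
have r1_gt0 : 0 < r 1%N by apply: le_lt_trans lt1; rewrite mulr_ge0// ltW.
have r0_gt0 : 0 < r 0%N.
  rewrite lt_neqAle r0 andbT; apply/eqP => r00; have := r2 1%N.
  by rewrite -r00 mul0r leNgt exprn_gt0.
pose q := r 1%N / (c * r 0%N).
have q1 : 1 < q by rewrite /q ltr_pdivlMr ?mul1r// mulr_gt0.
have rq k : r 0%N * (q * c) ^+ (2 ^ k) <= r (2 ^ k)%N.
  elim: k => [|k IHk].
    by rewrite expn0 expr1 /q le_eqVlt; apply/orP; left; apply/eqP; field;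
      rewrite !gt_eqF.
  rewrite expnS mul2n -addnn -(ler_pM2l r0_gt0); apply: le_trans (r2 _).
  apply: le_trans (_ : (r 0%N * (q * c) ^+ (2 ^ k)) ^+ 2 <= _).
    rewrite exprD; set X := (q * c) ^+ _.
    by rewrite le_eqVlt; apply/orP; left; apply/eqP; ring.
  rewrite ler_pXn2r ?nnegrE// mulr_ge0// exprn_ge0// mulr_ge0// ltW//.
  exact: lt_trans q1.
have qC n : (q - 1) *+ n <= C / r 0%N.
  rewrite ler_pdivlMr// mulrC.
  apply: (@le_trans _ _ (r 0%N * q ^+ (2 ^ n))).
    rewrite ler_pM2l//; apply: le_trans (bernoulli_le _ (ltW q1)).
    rewrite -[leLHS]add0r lerD// ler_wpMn2l// ?subr_ge0 1?ltW//.
    exact/ltnW/ltn_expl.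
  have := le_trans (rq n) (rC _); rewrite exprMn mulrA ler_pM2r//.
  exact: exprn_gt0.
have q10 : 0 < q - 1 by rewrite subr_gt0.
have := archi_boundP (normr_ge0 (C / r 0%N / (q - 1))).
set n := archi_bound _ => nP.
have := qC n; rewrite leNgt -mulr_natr -ltr_pdivrMl// mulrC.
by rewrite (le_lt_trans (ler_norm _) nP).
Qed.

(** The form needed for a self-adjoint operator a that is only known to act on a
    subspace, with r n = |a^n x|: the first hypothesis on squares is Cauchy-Schwarz
    for |a^n x|^2 = <x, a^(2n) x>, and the conclusion bounds |a x| by c |x| although
    the constant C may depend on x. *)
Lemma squaring_growth_bound (r : nat -> R[i]) (C c : R[i]) : 0 < c -> (forall n, 0 <= r n) ->
  (forall n, r n ^+ 2 <= r 0%N * r (n + n)%N) -> (forall n, r n <= C * c ^+ n) ->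
  r 1%N <= c * r 0%N.
Proof.
move=> c0 r0 r2 rC.
have rE n : (complex.Re (r n))%:C%C = r n by exact/RRe_real/ger0_real.
have cE : (complex.Re c)%:C%C = c by exact/RRe_real/gtr0_real.
have CE : (complex.Re C)%:C%C = C.
  apply/RRe_real/ger0_real; apply: le_trans (r0 0%N) _.
  by have := rC 0%N; rewrite expr0 mulr1.
rewrite -(rE 1%N) -(rE 0%N) -cE -rmorphM lecR.
apply: (@squaring_growth_bound_real (fun n => complex.Re (r n)) (complex.Re C)) => [|n|n|n].
- by rewrite -ltcR cE.
- by rewrite -lecR rE.
- by rewrite -lecR rmorphXn rmorphM/= !rE.
- by rewrite -lecR rmorphM rmorphXn/= rE CE cE.
Qed.

End SquaringGrowth.

Section Representations.
Context {R : realType} {H K : hilbertType R}.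
Implicit Types E : hilbertType R.
Variable N : set 'B(K).
Hypothesis vN_N : von_neumann_algebra N.

(** The structure common to y |-> y ⊗ 1 and to the representation of a minimal
    dilation that the comparison of dilations rests on. *)
Record star_rep E (pi : 'B(K) -> 'B(E)) : Prop := {
  rep_unit : pi idop = idop ;
  rep_comp : forall x y, N x -> N y -> pi (x ∘ y) = pi x ∘ pi y ;
  rep_adj : forall x, N x -> pi x^† = (pi x)^† }.

(** Finite sums of vectors pi(y) v xi are encoded by lists of pairs (y, xi), so that two
    representations can be compared on the same list. *)
Definition orbit_sum E (pi : 'B(K) -> 'B(E)) (v : 'B(H, E))
    (s : seq ('B(K) * H)) : E :=
  \sum_(p <- s) pi p.1 (v p.2).

Lemma orbit_sum_inner E (pi : 'B(K) -> 'B(E)) (v w : 'B(H, E))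
    (s t : seq ('B(K) * H)) : star_rep pi ->
  (forall p, p \in s -> N p.1) -> (forall p, p \in t -> N p.1) ->
  inner (orbit_sum pi v s) (orbit_sum pi w t) =
  \sum_(p <- s) \sum_(q <- t)
    inner p.2 ((v^† ∘ pi (p.1^† ∘ q.1) ∘ w) q.2).
Proof.
move=> rpi sN tN; rewrite /orbit_sum inner_suml; apply: eq_big_seq => p ps.
rewrite inner_sumr; apply: eq_big_seq => q qs.
rewrite (rep_comp rpi) ?(rep_adj rpi)//=; last exact: tN.
  by rewrite !adjopPr.
- exact: sN.
- by apply: (vN_adj vN_N); exact: sN.
Qed.

(** The pairs of orbit sums form a bounded linear relation that is invariant under
    (pi(y), rho(y)). Let z be its adjoint. Then z rho(y) = pi(y) z: the difference of
    the two sides, applied to eta, is orthogonal to the domain of the relation, and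
    also lies in its double orthogonal complement, so it is zero. Take u = z*. *)
Lemma orbit_sum_intertwiner E F (pi : 'B(K) -> 'B(E)) (rho : 'B(K) -> 'B(F))
    (v : 'B(H, E)) (w : 'B(H, F)) (c : R[i]) :
  star_rep pi -> star_rep rho -> 0 <= c ->
  (forall s, (forall p, p \in s -> N p.1) ->
    `|orbit_sum rho w s| <= c * `|orbit_sum pi v s|) ->
  exists u : 'B(E, F), (forall y, N y -> u ∘ pi y = rho y ∘ u) /\ u ∘ v = w.
Proof.
move=> rpi rrho c0 sc.
pose G : set (E * F) := [set x | exists s, (forall p, p \in s -> N p.1) /\
  x = (orbit_sum pi v s, orbit_sum rho w s)].
have Gs : Defs.subspace G.
  split=> [|a _ _ [s [sN ->]] [t [tN ->]]].
    by exists [::]; split=> //; rewrite /orbit_sum !big_nil.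
  exists ([seq (p.1, a *: p.2) | p <- s] ++ t); split.
    by move=> p; rewrite mem_cat => /orP[/mapP[q /sN ? ->]|/tN].
  rewrite /orbit_sum !big_cat !big_map /=; apply/pair_equal_spec; split=> /=;
    by rewrite scaler_sumr; congr (_ + _); apply: eq_bigr => p _; rewrite !linearZ.
have Gc x : G x -> `|x.2| <= c * `|x.1|.
  by move=> [s [sN ->]]; exact: sc.
have Gpi y x : N y -> G x -> G (pi y x.1, rho y x.2).
  move=> Ny [s [sN ->]]; exists [seq (y ∘ p.1, p.2) | p <- s]; split.
    by move=> _ /mapP[q /sN Nq ->]; exact: (vN_comp vN_N).
  rewrite /orbit_sum !big_map !linear_sum /=; congr (_, _);
    by apply: eq_big_seq => p /sN Np; rewrite /= ?(rep_comp rpi) ?(rep_comp rrho).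
have [z [zG zo]] := relation_adjoint Gs c0 Gc.
(* These forms let pi y and rho y be moved across inner products. *)
have piN y : N y -> pi y = (pi y^†)^†.
  by move=> Ny; rewrite (rep_adj rpi)// adjopK.
have rhoN y : N y -> rho y = (rho y^†)^†.
  by move=> Ny; rewrite (rep_adj rrho)// adjopK.
have z_int y : N y -> z ∘ rho y = pi y ∘ z.
  move=> Ny; have Ny' := vN_adj vN_N Ny.
  apply: bounded_op_ext => eta /=; apply/eqP; rewrite -subr_eq0; apply/eqP.
  (* d is orthogonal to the domain, and in its double orthogonal complement. *)
  set d := _ - _.
  have dG x : G x -> inner d x.1 = 0.
    move=> Gx; rewrite /d innerBl zG// piN// rhoN// !adjopP.
    by rewrite (zG _ _ (Gpi _ _ Ny' Gx)) subrr.
  apply/inner_eq0; rewrite {2}/d innerBr zo// sub0r -adjopP -rep_adj//.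
  rewrite zo ?oppr0// => x Gx; rewrite (rep_adj rpi)// adjopP.
  exact: (dG _ (Gpi _ _ Ny Gx)).
exists z^†; split=> [y Ny|].
  rewrite piN// -adjop_comp -z_int; last exact: (vN_adj vN_N).
  by rewrite adjop_comp -rhoN.
apply: bounded_op_ext => xi; apply: inner_inj => eta; rewrite /= adjopPr.
have GN : G (v xi, w xi).
  exists [:: (idop, xi)]; split.
    by move=> p; rewrite inE => /eqP ->; exact: (vN_unit vN_N).
  by rewrite /orbit_sum !big_seq1 /= (rep_unit rpi) (rep_unit rrho).
by rewrite (zG _ _ GN).
Qed.

Definition intertwined_range E (pi : 'B(K) -> 'B(E)) (v : 'B(H, E)) : set 'B(H, K) :=
  [set x ∘ v | x in intertwiners N pi].

Lemma intertwined_range_transfer E F (pi : 'B(K) -> 'B(E)) (rho : 'B(K) -> 'B(F))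
    (u : 'B(E, F)) (v : 'B(H, E)) :
  (forall y, N y -> u ∘ pi y = rho y ∘ u) ->
  intertwined_range rho (u ∘ v) `<=` intertwined_range pi v.
Proof.
move=> u_int _ [x xI <-]; exists (x ∘ u); last by rewrite compopA.
by move=> y Ny; rewrite compopA xI// -!compopA u_int.
Qed.

(** The inner products of orbit sums of a dilation depend on theta only, so the bound of
    [orbit_sum_intertwiner] holds with constant 1. *)
Lemma dilation_range_sub E F (pi : 'B(K) -> 'B(E)) (rho : 'B(K) -> 'B(F))
    (v : 'B(H, E)) (w : 'B(H, F)) :
  star_rep pi -> star_rep rho ->
  (forall y, N y -> v^† ∘ pi y ∘ v = w^† ∘ rho y ∘ w) ->
  intertwined_range rho w `<=` intertwined_range pi v.
Proof.
move=> rpi rrho vw.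
have [|u [u_int <-]] := @orbit_sum_intertwiner _ _ _ _ v w 1 rpi rrho ler01.
  move=> s sN; rewrite mul1r -(@ler_pXn2r _ 2)// ?nnegrE//.
  rewrite -!innerxx !orbit_sum_inner// le_eqVlt; apply/orP; left; apply/eqP.
  apply: eq_big_seq => p ps; apply: eq_big_seq => q qs; rewrite vw//.
  by apply: (vN_comp vN_N); [apply: (vN_adj vN_N); exact: sN|exact: sN].
exact: intertwined_range_transfer.
Qed.

Lemma orbit_sum_growth E (pi : 'B(K) -> 'B(E)) (v : 'B(H, E)) (a : nat -> 'B(H))
    (c : R[i]) s : (forall n xi, `|a n xi| <= c ^+ n * `|xi|) ->
  exists C : R[i], forall n, `|orbit_sum pi (v ∘ a n) s| <= C * c ^+ n.
Proof.
move=> ac; elim: s => [|p s [C sC]].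
  by exists 0 => n; rewrite /orbit_sum big_nil normr0 mul0r.
have [d d0 pd] := bounded_op_bound (pi p.1 ∘ v).
exists (d * `|p.2| + C) => n; rewrite /orbit_sum big_cons mulrDl.
apply: le_trans (ler_normD _ _) _; rewrite lerD//; last exact: sC.
apply: le_trans (pd _) _.
by rewrite -mulrA ler_pM2l// mulrC; exact: ac.
Qed.

Section Dilation.
Context {E : hilbertType R}.
Variables (theta : 'B(K) -> 'B(H)) (pi : 'B(K) -> 'B(E)) (v : 'B(H, E)).
Hypothesis rpi : star_rep pi.
Hypothesis v_dil : forall y, N y -> theta y = v^† ∘ pi y ∘ v.

(** The operator pi(y) v xi |-> pi(y) v b xi has pi(y) v xi |-> pi(y) v b* xi as its
    formal adjoint, because b* commutes with theta(N). *)
Lemma orbit_sum_shift (b d : 'B(H)) s : (forall p, p \in s -> N p.1) ->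
  (forall y, N y -> b^† ∘ theta y = theta y ∘ b^†) ->
  inner (orbit_sum pi (v ∘ b) s) (orbit_sum pi (v ∘ d) s) =
  inner (orbit_sum pi v s) (orbit_sum pi (v ∘ (b^† ∘ d)) s).
Proof.
move=> sN bC; rewrite !orbit_sum_inner//.
apply: eq_big_seq => p ps; apply: eq_big_seq => q qs.
have Npq : N (p.1^† ∘ q.1).
  by apply: (vN_comp vN_N); [apply: (vN_adj vN_N); exact: sN|exact: sN].
have := bC _ Npq; rewrite v_dil// adjop_comp !compopA.
by move=> ->.
Qed.

(** Put a = b* b. On orbit sums a acts as a symmetric operator, and
    |sum pi(y) v b xi|^2 = <sum pi(y) v xi, sum pi(y) v a xi>, so it suffices to bound
    the action of a. The crude estimate
    |sum pi(y) v a^n xi| <= C c^n, with C depending on the sum, is turned into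
    the bound c by [squaring_growth_bound]. *)
Lemma commuting_orbit_bound (b : 'B(H)) :
  (forall y, N y -> b ∘ theta y = theta y ∘ b) ->
  (forall y, N y -> b^† ∘ theta y = theta y ∘ b^†) ->
  exists2 c : R[i], 0 <= c & forall s, (forall p, p \in s -> N p.1) ->
    `|orbit_sum pi (v ∘ b) s| <= c * `|orbit_sum pi v s|.
Proof.
move=> bC bC'.
pose a := b^† ∘ b; pose pow n := iter n (compop a) (@idop _ H).
have a_adj : a^† = a by rewrite /a adjop_comp adjopK.
have pow_add m n : pow m ∘ pow n = pow (m + n)%N.
  elim: m => [|m IHm]; first by rewrite comp1op.
  by rewrite addSn /= -IHm compopA.
have pow1 : pow 1%N = a by rewrite /pow /= compop1.
have pow_adj n : (pow n)^† = pow n.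
  elim: n => [|n IHn]; first by apply: adjop_eq.
  by rewrite /= adjop_comp IHn a_adj -[in LHS]pow1 pow_add addn1.
have a_comm y : N y -> a ∘ theta y = theta y ∘ a.
  by move=> Ny; rewrite /a -compopA bC// compopA bC'// compopA.
have pow_comm n y : N y -> pow n ∘ theta y = theta y ∘ pow n.
  move=> Ny; elim: n => [|n IHn]; first by rewrite comp1op compop1.
  by rewrite /= -compopA IHn compopA a_comm// -compopA.
have [c c0 ac] := bounded_op_bound a.
exists (c + 1) => [|s sN]; first by rewrite addr_ge0// ltW.
pose r n := `|orbit_sum pi (v ∘ pow n) s|.
have r0 : r 0%N = `|orbit_sum pi v s| by rewrite /r compop1.
have r_sqr n : r n ^+ 2 = inner (orbit_sum pi v s) (orbit_sum pi (v ∘ pow (n + n)%N) s).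
  rewrite /r -innerxx orbit_sum_shift// pow_adj ?pow_add//.
  exact: pow_comm.
have b_sqr : `|orbit_sum pi (v ∘ b) s| ^+ 2 =
    inner (orbit_sum pi v s) (orbit_sum pi (v ∘ pow 1%N) s).
  by rewrite -innerxx orbit_sum_shift// pow1.
have r1 : r 1%N <= c * r 0%N.
  have [C sC] : exists C : R[i], forall n, r n <= C * c ^+ n.
    apply: orbit_sum_growth => n xi; elim: n => [|n IHn]; first by rewrite mul1r.
    rewrite exprS -mulrA /=; apply: le_trans (ac _) _.
    by rewrite ler_pM2l.
  apply: (squaring_growth_bound (C := C)) => // n; first exact: normr_ge0.
  rewrite r_sqr r0; apply: le_trans (inner_norm_le _ _).
  by apply: real_ler_norm; rewrite -r_sqr rpredX// normr_real.
rewrite -(@ler_pXn2r _ 2)// ?nnegrE ?mulr_ge0 ?addr_ge0 ?(ltW c0)//.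
apply: (@le_trans _ _ (r 0%N * r 1%N)).
  rewrite b_sqr r0; apply: le_trans (inner_norm_le _ _).
  by apply: real_ler_norm; rewrite -b_sqr rpredX// normr_real.
rewrite -r0 exprMn; apply: (@le_trans _ _ (c * r 0%N ^+ 2)).
  by rewrite expr2 mulrCA ler_wpM2l// normr_ge0.
rewrite ler_wpM2r ?exprn_ge0 ?normr_ge0//.
rewrite (_ : (c + 1) ^+ 2 = c + (c ^+ 2 + c + 1)); last by ring.
by rewrite lerDl !addr_ge0// ?exprn_ge0// ltW.
Qed.

Lemma intertwined_range_module (b : 'B(H)) x :
  (forall y, N y -> b ∘ theta y = theta y ∘ b) ->
  (forall y, N y -> b^† ∘ theta y = theta y ∘ b^†) ->
  intertwined_range pi v x -> intertwined_range pi v (x ∘ b).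
Proof.
move=> bC bC' [z zI <-].
have [c c0 bc] := commuting_orbit_bound bC bC'.
have [u [u_int uv]] := orbit_sum_intertwiner rpi rpi c0 bc.
apply: (intertwined_range_transfer u_int); rewrite uv.
by exists z; rewrite ?compopA.
Qed.

End Dilation.

Lemma intertwined_range_subspace E (pi : 'B(K) -> 'B(E)) (v : 'B(H, E)) :
  Defs.subspace (intertwined_range pi v).
Proof.
split.
  exists 0; last exact: bounded_op_ext.
  by move=> y Ny; apply: bounded_op_ext => xi /=; rewrite linear0.
move=> a _ _ [x xI <-] [y yI <-]; exists (a *: x + y); last exact: compopDl.
by move=> z Nz; rewrite compopDr compopDl xI// yI.
Qed.

Lemma intertwined_range_lmul E (pi : 'B(K) -> 'B(E)) (v : 'B(H, E)) (a : 'B(K)) x :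
  commutant N a -> intertwined_range pi v x -> intertwined_range pi v (a ∘ x).
Proof.
move=> aN [z zI <-]; exists (a ∘ z); last by rewrite compopA.
by move=> y Ny; rewrite compopA -aN// -!compopA zI.
Qed.

End Representations.

(** * The quantum relation of a dilation *)

Section Subspaces.

Lemma lin_subspace (C : pzRingType) (V : lmodType C) (A : set V) :
  Defs.subspace (lin A).
Proof.
split=> [S [[S0 _] _]|a x y Ax Ay S [Ss AS]] //.
by case: (Ss) => _; apply; [apply: Ax|apply: Ay].
Qed.

Lemma subspace_sum (C : pzRingType) (V : lmodType C) (A : set V)
    (I : eqType) (r : seq I) (F : I -> V) :
  Defs.subspace A -> (forall i, i \in r -> A (F i)) -> A (\sum_(i <- r) F i).
Proof.
move=> [A0 AD] rA; rewrite big_seq; elim/big_ind : _ => // x y Ax Ay.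
by have := AD 1 x y Ax Ay; rewrite scale1r.
Qed.

End Subspaces.

Section Relation.
Context {R : realType} {H K L : hilbertType R} (T : hilbert_tensor K L).
Variable N : set 'B(K).

Lemma tensor_id_star_rep : star_rep N (tensor_id T).
Proof.
split; first exact: tensor_id1.
  by move=> x y _ _; exact: tensor_id_comp.
by move=> x _; exact: tensor_id_adj.
Qed.

(** Orthonormal families ordered by the finite sets of vectors that their spans
    contain; it replaces a sequence because L may be nonseparable. *)
Definition orthonormal_filter : set_system (seq L) :=
  filter_from [set: seq L] (fun s => [set e |
    orthonormal (@hform R L) e /\ {in s, forall l, ortho_proj e l = l}]).

Lemma orthonormal_filter_proper : ProperFilter orthonormal_filter.
Proof.
apply: filter_from_proper; last by move=> s _; have [e] := gram_schmidt s; exists e.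
apply: filter_from_filter; first by exists [::].
move=> s t _ _; exists (s ++ t) => // e [eo es]; split; split => // l ls;
  by apply: es; rewrite mem_cat ls ?orbT.
Qed.

Lemma tens_proj_weakstar_cvg (v : 'B(H, T)) (z : 'B(T, K)) :
  (z ∘ tens_proj T e ∘ v) @[e --> orthonormal_filter] --> (z ∘ v).
Proof.
have FF := orthonormal_filter_proper.
have FS : Filter orthonormal_filter by exact: filter_filter.
have FF' : Filter ((z ∘ tens_proj T e ∘ v) @[e --> orthonormal_filter]).
  exact: fmap_filter.
apply/(weakstar_cvgP _ FF') => p; apply/cvgrPdist_lt => eps eps0.
have [c c0 zc] := bounded_op_bound z; have [d d0 vd] := bounded_op_bound v.
pose y e : 'B(H, K) := (-1) *: (z ∘ tens_proj T e ∘ v) + z ∘ v.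
have yE e xi : y e xi = z (v xi - tens_proj T e (v xi)).
  by rewrite /y bounded_op_scaleD /= scaleN1r linearB addrC.
(* All operators y e with e orthonormal have norm at most c * d. *)
have cd0 : 0 <= c * d by rewrite mulr_ge0// ltW.
have [b bc yb] := predual_term_le p cd0.
pose t e n : R[i]^o := inner ((sval p).2 n) (y e ((sval p).1 n)).
have t_dom : orthonormal_filter [set e | forall n, `|t e n| <= b n].
  exists [::] => // e [eo _] n; apply: yb => xi; rewrite yE.
  apply: le_trans (zc _) _; rewrite -mulrA ler_pM2l//.
  exact: le_trans (tens_projC_norm _ eo) (vd _).
have t_cvg n (e : R[i]) : 0 < e -> orthonormal_filter [set i | `|t i n| < e].
  move=> e0; pose eta := (sval p).2 n; pose xi := (sval p).1 n.
  have A0 : 0 < `|eta| * c + 1 by rewrite ltr_wpDl// mulr_ge0// ltW.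
  have eA : 0 < e / (`|eta| * c + 1) by rewrite divr_gt0.
  have [s sP] := tens_proj_cvg (v xi) eA.
  exists s => // f [fo fs]; rewrite /t /mkset yE.
  apply: le_lt_trans (inner_norm_le _ _) _.
  apply: (@le_lt_trans _ _ (`|eta| * (c * (e / (`|eta| * c + 1))))).
    rewrite ler_wpM2l//; apply: le_trans (zc _) _.
    by rewrite ler_pM2l// ltW//; exact: sP.
  rewrite !mulrA ltr_pdivrMr// mulrC ltr_pM2l//.
  by rewrite ltrDl.
have small := @dominated_lim_series _ _ orthonormal_filter b t FS t_dom bc t_cvg _ eps0.
suff : orthonormal_filter [set e | `|predual_pairing (z ∘ v) p -
    predual_pairing (z ∘ tens_proj T e ∘ v) p| < eps] by [].
apply: (@filterS _ orthonormal_filter FS _ _ _ small) => e small_e; rewrite /mkset.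
have -> : predual_pairing (z ∘ v) p - predual_pairing (z ∘ tens_proj T e ∘ v) p =
    predual_pairing (y e) p.
  by rewrite /y predual_pairingP mulN1r addrC.
exact: small_e.
Qed.

(** Operators y' (1 ⊗ <xi|) with y' in N' intertwine y ⊗ 1 with y. Conversely an
    intertwiner z is approximated by the operators z (1 ⊗ P), finite sums of
    z_a (1 ⊗ <a|) whose coefficients z_a = z (- ⊗ a) are in N'. *)
Lemma relation_ofE (v : 'B(H, T)) :
  relation_of N v = closure (intertwined_range N (tensor_id T) v).
Proof.
rewrite /relation_of; set A := [set _ | _ in _ & _ in _].
apply/seteqP; split.
  apply: closure_subset => x Ax; apply: Ax; split.
    exact: intertwined_range_subspace.
  move=> _ [xi _ [y' Ny' <-]]; exists (y' ∘ id_tensor_bra T xi) => //.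
  move=> y Ny; rewrite compopA -Ny'// -!compopA; congr (_ ∘ _).
  apply: tens_ext => k l /=.
  by rewrite tensor_idE id_tensor_braE !adj_tens_right linearZ.
have AA : intertwined_range N (tensor_id T) v `<=` closure (lin A).
  move=> _ [z zI <-] B Bz.
  have FF := orthonormal_filter_proper.
  have Bproj : orthonormal_filter [set e | B (z ∘ tens_proj T e ∘ v)].
    exact: (@tens_proj_weakstar_cvg v z B Bz).
  have [e Be] := filter_ex Bproj.
  exists (z ∘ tens_proj T e ∘ v); split => //.
  have -> : z ∘ tens_proj T e ∘ v =
      \sum_(a <- e) (z ∘ tens_right T a ∘ id_tensor_bra T a ∘ v).
    apply: bounded_op_ext => xi; rewrite bounded_op_sum /= tens_projE linear_sum.
    by apply: eq_bigr => a _; rewrite id_tensor_braE.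
  apply: subspace_sum; first exact: lin_subspace.
  move=> a _; apply: sub_gen_smallest; exists a => //.
  exists (z ∘ tens_right T a) => // y Ny.
  rewrite compopA zI// -!compopA; congr (_ ∘ _).
  by apply: bounded_op_ext => k /=; rewrite tensor_idE.
move=> x /(closure_subset AA).
by rewrite -(closure_id _).1//; exact: closed_closure.
Qed.

End Relation.

Theorem theorem4p2 (R : realType) (H K : hilbertType R)
  (M : set 'B(H)) (N : set 'B(K)) (theta : 'B(K) -> 'B(H))
  (L : hilbertType R) (KL : hilbert_tensor K L) (v : 'B(H, KL)) :
  von_neumann_algebra M -> von_neumann_algebra N -> normal_cp N M theta ->
  dilates N theta v ->
  [/\ quantum_relation M N (relation_of N v),
      (forall (L' : hilbertType R) (KL' : hilbert_tensor K L') (v' : 'B(H, KL')),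
         dilates N theta v' -> relation_of N v' = relation_of N v)
    & forall (H0 : hilbertType R) (pi0 : 'B(K) -> 'B(H0)) (v0 : 'B(H, H0)),
         minimal_dilation N theta pi0 v0 ->
         relation_of N v =
           closure [set x ∘ v0 | x in intertwiners N pi0]].
Proof.
move=> vN_M vN_N theta_cp v_dil.
have same_range E F (pi : 'B(K) -> 'B(E)) (rho : 'B(K) -> 'B(F))
    (x : 'B(H, E)) (w : 'B(H, F)) : star_rep N pi -> star_rep N rho ->
    (forall y, N y -> theta y = x^† ∘ pi y ∘ x) ->
    (forall y, N y -> theta y = w^† ∘ rho y ∘ w) ->
    intertwined_range N pi x = intertwined_range N rho w.
  move=> rpi rrho xd wd; apply/seteqP; split; apply: dilation_range_sub => // y Ny;
    by rewrite -xd// -wd.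
split.
- split; rewrite relation_ofE.
  + exact/closure_subspace/intertwined_range_subspace.
  + exact: closed_closure.
  + move=> a x b aN Vx bM.
    have b_comm y : N y -> b ∘ theta y = theta y ∘ b.
      by move=> Ny; apply: bM; exact: (ncp_fun theta_cp).
    have b_adj_comm y : N y -> b^† ∘ theta y = theta y ∘ b^†.
      move=> Ny; have My := vN_adj vN_M (ncp_fun theta_cp Ny).
      rewrite -[theta y]adjopK -!adjop_comp; congr adjop.
      by rewrite -bM.
    move: x Vx; apply: (closure_map (compop_weakstar_continuous (a := a) (b := b))).
    move=> x xV; apply: subset_closure.
    apply: (intertwined_range_module vN_N (tensor_id_star_rep KL N) v_dil) => //.
    exact: intertwined_range_lmul.
- move=> L' KL' v' v'_dil; rewrite !relation_ofE.
  by congr closure; apply: same_range => //; exact: tensor_id_star_rep.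
- move=> H0 pi0 v0 [pi0_hom v0_dil _]; rewrite relation_ofE.
  congr closure; apply: same_range => //; first exact: tensor_id_star_rep.
  by case: pi0_hom => _ *; split.
Qed.
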